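(* Let $R$ be a commutative Noetherian ring, $I,J$ ideals of $R$, $t\ge0$ an integer, $M$ an $R$-module, and $\mathcal S$ a Serre subcategory of $R$-modules. Let $\mathfrak a\in\tilde W(I,J)$ be such that $\operatorname{Ext}^t_R(R/\mathfrak a,M)\in\mathcal S$ and $\operatorname{Ext}^{n-j}_R(R/\mathfrak a,H^j_{I,J}(M))\in\mathcal S$ for $n=t,t+1$ and all $j<t$. Then $\operatorname{Hom}_R(R/\mathfrak a,H^t_{I,J}(M))\in\mathcal S$.
   Context: For ideals $I,J$ of $R$, $\tilde W(I,J)$ denotes the set of ideals $\mathfrak a$ of $R$ such that $I^n\subseteq\mathfrak a+J$ for some integer $n\ge1$. For an $R$-module $X$, $\Gamma_{I,J}(X)=\{x\in X: I^nx\subseteq Jx\text{ for some } n\ge1\}$; this defines a left exact functor $\Gamma_{I,J}$ on $R$-modules, and $H^i_{I,J}$ denotes its $i$-th right derived functor (local cohomology with respect to the pair of ideals $(I,J)$). A Serre subcategory of $R$-modules is a class of $R$-modules closed under taking submodules, quotients and extensions (and isomorphisms, and containing $0$). *)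

(* Defs.v *)
From HB Require Import structures.
From mathcomp Require Import all_boot all_order all_algebra.
From mathcomp Require Import boolp classical_sets functions.

Set Implicit Arguments.
Unset Strict Implicit.
Unset Printing Implicit Defensive.

Import Order.TTheory GRing.Theory Num.Theory.
Local Open Scope ring_scope.
Local Open Scope quotient_scope.
Local Open Scope classical_set_scope.

Section Submodule.
Context (R : pzRingType) (V : lmodType R).

Record submod (S : submodClosed V) :=
  Submod { submod_val :> V; submod_valP : submod_val \in S }.

Section Instances.
Context (S : submodClosed V).
HB.instance Definition _ := [isSub for @submod_val S].
HB.instance Definition _ := [Choice of submod S by <:].
HB.instance Definition _ := [SubChoice_isSubLmodule of submod S by <:].
End Instances.

Definition set_pred (P : set V) : V -> bool := fun x => `[< P x >].

Definition submod_set (P : set V) : Prop :=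
  P 0 /\ forall (a : R) x y, P x -> P y -> P (a *: x + y).

Lemma set_pred_closed (P : set V) : submod_set P -> submod_closed (set_pred P).
Proof.
move=> [P0 PD]; split; first exact/asboolP.
by move=> a x y /asboolP Px /asboolP Py; apply/asboolP/PD.
Qed.

Definition mk_submod (P : set V) (hP : submod_set P) : submodClosed V :=
  HB.pack (set_pred P)
    (GRing.isSubmodClosed.Build R V (set_pred P) (set_pred_closed hP)).

Lemma mk_submodP (P : set V) (hP : submod_set P) x :
  reflect (P x) (x \in mk_submod hP).
Proof. exact: asboolP. Qed.

End Submodule.

Section Restriction.
Context (R : pzRingType) (V W : lmodType R).
Context (S : submodClosed V) (T : submodClosed W).
Context (f : {linear V -> W}) (fST : forall x, x \in S -> f x \in T).

Definition restr (x : submod S) : submod T := Submod (fST (submod_valP x)).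

Lemma restr_linear : linear restr.
Proof. by move=> a x y; apply: val_inj; rewrite /= !linearP. Qed.

HB.instance Definition _ :=
  GRing.isLinear.Build R (submod S) (submod T) *:%R restr restr_linear.

End Restriction.

Section QuotientModule.
Context (R : pzRingType) (V : lmodType R) (S : submodClosed V).

Definition submod_zpred : V -> bool := fun x => x \in S.

Lemma submod_zpred_closed : zmod_closed submod_zpred.
Proof. exact: (GRing.submodClosedP S : zmod_closed _). Qed.

Definition submod_zclosed : zmodClosed V :=
  HB.pack submod_zpred (GRing.isZmodClosed.Build V submod_zpred submod_zpred_closed).

(** [Quotient.quot] only provides the additive group; the scalar action is added
    below. *)
Definition qmod : Type := Quotient.quot submod_zclosed.
HB.instance Definition _ := GRing.Zmodule.on qmod.

Definition qproj (x : V) : qmod := \pi_(Quotient.quot submod_zclosed) x.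

Lemma qproj_eqP x y : reflect (qproj x = qproj y) (x - y \in S).
Proof. by rewrite -[_ \in S]/(_ \in submod_zclosed) Quotient.idealrBE; exact: eqP. Qed.

Lemma qproj_surj (u : qmod) : exists x, qproj x = u.
Proof. by exists (repr (u : Quotient.quot submod_zclosed)); rewrite /qproj reprK. Qed.

Lemma qproj_zmod : zmod_morphism qproj.
Proof. by move=> x y; rewrite /qproj raddfB. Qed.

Let qprojD x y : qproj (x + y) = qproj x + qproj y.
Proof. by rewrite /qproj raddfD. Qed.

Definition qscale (a : R) (u : qmod) : qmod :=
  qproj (a *: repr (u : Quotient.quot submod_zclosed)).

Lemma qscale_proj a x : qscale a (qproj x) = qproj (a *: x).
Proof.
apply/qproj_eqP; rewrite -scalerBr; apply: rpredZ; apply/qproj_eqP.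
by rewrite /qproj reprK.
Qed.

Fact qscaleA a b u : qscale a (qscale b u) = qscale (a * b) u.
Proof. by have [x <-] := qproj_surj u; rewrite !qscale_proj scalerA. Qed.
Fact qscale1 : left_id 1 qscale.
Proof. by move=> u; have [x <-] := qproj_surj u; rewrite qscale_proj scale1r. Qed.
Fact qscaleDr : right_distributive qscale +%R.
Proof.
move=> a u v; have [x <-] := qproj_surj u; have [y <-] := qproj_surj v.
by rewrite -qprojD !qscale_proj -qprojD scalerDr.
Qed.
Fact qscaleDl u : {morph qscale^~ u : a b / a + b}.
Proof.
by move=> a b; have [x <-] := qproj_surj u; rewrite !qscale_proj scalerDl qprojD.
Qed.

HB.instance Definition _ := GRing.Zmodule_isLmodule.Build R qmod
  qscaleA qscale1 qscaleDr qscaleDl.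

Lemma qproj_linear : linear qproj.
Proof. by move=> a x y; rewrite qprojD -qscale_proj. Qed.

HB.instance Definition _ :=
  GRing.isLinear.Build R V qmod *:%R qproj qproj_linear.

End QuotientModule.

Section KernelImage.
Context (R : pzRingType) (U V W : lmodType R).

Lemma kernel_submod_set (g : {linear V -> W}) : submod_set [set x | g x = 0].
Proof.
by split=> /= [|a x y gx gy]; rewrite ?linear0 // linearP gx gy scaler0 addr0.
Qed.

Definition kernel (g : {linear V -> W}) : submodClosed V :=
  mk_submod (kernel_submod_set g).

Lemma image_submod_set (f : {linear U -> V}) (S : submodClosed V) :
  submod_set [set x : submod S | exists u, f u = x :> V].
Proof.
split=> /= [|a x y [u fu] [v fv]]; first by exists 0; rewrite linear0.
by exists (a *: u + v); rewrite linearP fu fv.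
Qed.

(** The image of [f], cut down to the submodule [S]. *)
Definition image_in (f : {linear U -> V}) (S : submodClosed V) :
    submodClosed (submod S) :=
  mk_submod (image_submod_set f S).

(** [ker g / (im f :&: ker g)]; for [g \o f = 0] this is the usual homology of
    [U -> V -> W] at [V]. *)
Definition homology (f : {linear U -> V}) (g : {linear V -> W}) : lmodType R :=
  qmod (image_in f (kernel g)).

End KernelImage.

Definition injective_module (R : pzRingType) (E : lmodType R) : Prop :=
  forall (A B : lmodType R) (i : {linear A -> B}) (f : {linear A -> E}),
    injective i -> exists g : {linear B -> E}, forall x, g (i x) = f x.

Record injective_resolution (R : pzRingType) (M : lmodType R) := InjRes {
  ir_obj :> nat -> lmodType R;
  ir_diff : forall n, {linear ir_obj n -> ir_obj n.+1};
  ir_aug : {linear M -> ir_obj 0};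
  ir_injective : forall n, injective_module (ir_obj n);
  ir_aug_inj : injective ir_aug;
  ir_exact0 : forall x, ir_diff 0 x = 0 <-> exists m, ir_aug m = x;
  ir_exact : forall n x, ir_diff n.+1 x = 0 <-> exists y, ir_diff n y = x
}.

Record additive_functor (R : pzRingType) := AdditiveFunctor {
  fobj :> lmodType R -> lmodType R;
  fmap : forall A B : lmodType R, {linear A -> B} -> {linear fobj A -> fobj B};
  fmap_id : forall (A : lmodType R) x, fmap (idfun : {linear A -> A}) x = x;
  fmap_comp : forall (A B C : lmodType R)
    (g : {linear B -> C}) (f : {linear A -> B}) x,
    fmap (g \o f : {linear A -> C}) x = fmap g (fmap f x);
  fmapD : forall (A B : lmodType R) (f g : {linear A -> B}) x,
    fmap (f \+ g : {linear A -> B}) x = fmap f x + fmap g x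
}.

Section DivisibleExtension.
Context (B D : zmodType).
Context (divD : forall (n : nat) (y : D), (0 < n)%N -> exists d : D, d *+ n = y).

Let functional_subgroup (G : set (B * D)) : Prop :=
  [/\ G 0, forall p q, G p -> G q -> G (p - q) & forall y, G (0, y) -> y = 0].

Lemma int_extension (Q : int -> D -> Prop) :
  (forall k l y z, Q k y -> Q l z -> Q (k - l) (y - z)) ->
  (forall y, Q 0 y -> y = 0) ->
  exists d, forall k y, Q k y -> y = d *~ k.
Proof.
move=> QB Q0.
have QN k y : Q k y -> Q (- k) (- y).
  by move=> Qk; have := QB _ _ _ _ (QB _ _ _ _ Qk Qk) Qk; rewrite !subrr !sub0r.
have QD k l y z : Q k y -> Q l z -> Q (k + l) (y + z).
  by move=> Qk /QN Ql; rewrite -[l]opprK -[z]opprK; exact: QB.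
have [exn|nexn] := pselect (exists n : nat, `[< (0 < n)%N /\ exists y, Q n%:Z y >]).
  case: (ex_minnP exn) => n /asboolP[n0 [y0 Qn]] minn.
  have [d dn] := divD y0 n0; exists d.
  have Qmul (q : int) : Q (q * n%:Z) (y0 *~ q).
    have Qnat (m : nat) : Q (m%:Z * n%:Z) (y0 *+ m).
      elim: m => [|m IH]; first by rewrite mul0r mulr0n -(subrr n%:Z) -(subrr y0); exact: QB.
      by rewrite mulrSr -addn1 PoszD mulrDl mul1r; exact: QD.
    case: q => m; first exact: Qnat.
    by rewrite NegzE mulNr mulrNz; exact/QN/Qnat.
  move=> k y Qk; have nz : n%:Z != 0 by case: (n) n0.
  have Qr : Q (k %% n)%Z (y - y0 *~ (k %/ n)%Z) by rewrite [X in Q X](_ : _ = k - (k %/ n)%Z * n%:Z); [exact: QB|apply/eqP; rewrite eq_sym subr_eq addrC -divz_eq].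
  have r0 : (k %% n)%Z = 0.
    apply/eqP; apply: contraT => rn0.
    have rge := modz_ge0 k nz; have := ltz_pmod k (n0 : 0 < n%:Z).
    case: (k %% n)%Z rge rn0 Qr => // r _ rn0 Qr; rewrite ltz_nat ltnNge => /negP[].
    by apply: minn; apply/asboolP; split; [case: (r) rn0|exists (y - y0 *~ (k %/ n)%Z)].
  rewrite r0 in Qr; have /eqP := Q0 _ Qr; rewrite subr_eq0 => /eqP ->.
  by rewrite [in RHS](divz_eq k n) r0 addr0 -dn mulrC mulrzA.
exists 0 => k y Qk; rewrite mul0rz.
have pos (m : nat) z : Q m%:Z z -> m = 0%N.
  case: m => // m Qm; case: nexn; exists m.+1; apply/asboolP; split=> //.
  by exists z.
case: k Qk => m Qm; first by have := pos _ _ Qm => m0; rewrite m0 in Qm; exact: Q0.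
by have := QN _ _ Qm; rewrite NegzE opprK => /pos.
Qed.

Lemma divisible_extension (G0 : set (B * D)) : functional_subgroup G0 ->
  exists h : {additive B -> D}, forall b d, G0 (b, d) -> h b = d.
Proof.
move=> G0P; pose P (X : set (B * D)) := X = set0 \/ functional_subgroup X /\ G0 `<=` X.
have [F FP Ftot|A [PA maxA]] := @Zorn_bigcup (B * D)%type P.
  have [[X [FX [p Xp]]]|noX] := pselect (exists X, F X /\ X !=set0); last first.
    left; apply/seteqP; split=> // p [X FX Xp]; case: noX.
    by exists X; split=> //; exists p.
  have [X0|[XP G0X]] := FP _ FX; first by rewrite X0 in Xp.
  have FS Y p' : F Y -> Y p' -> functional_subgroup Y.
    by move=> FY Yp'; have [Y0|[]//] := FP _ FY; rewrite Y0 in Yp'.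
  right; split; last by move=> q /G0X Xq; exists X.
  split; first by exists X => //; case: XP.
    move=> q r [Y FY Yq] [Z FZ Zr]; have [YZ|ZY] := Ftot _ _ FY FZ.
      by exists Z => //; have [_ ZB _] := FS _ _ FZ Zr; exact/ZB/Zr/YZ.
    by exists Y => //; have [_ YB _] := FS _ _ FY Yq; exact/YB/ZY.
  by move=> y [Y FY Yy]; have [_ _ Y0] := FS _ _ FY Yy; exact: Y0.
have [A0|[AP G0A]] := PA.
  case: (maxA G0); last by right; split.
  by rewrite A0; split=> // G00; case: G0P => /G00.
have [A0 AB Af] := AP.
have total b : exists d, A (b, d).
  have [|y /Af//|d dP] := @int_extension (fun k y => A (b *~ k, y)).
    by move=> k l y z Ak Al; rewrite mulrzBr; exact: AB Ak Al.
  exists d; apply: contrapT => nA.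
  pose G := [set p | exists2 q, A q & exists k : int, p = q + (b *~ k, d *~ k)].
  apply: (maxA G); first split.
  - move=> p Ap; exists p => //; exists 0; rewrite !mulr0z.
    by case: p {Ap} => u v; congr pair; rewrite /= addr0.
  - move=> GA; apply/nA/GA; exists 0 => //; exists 1; rewrite !mulr1z.
    by congr pair; rewrite /= add0r.
  right; split; last first.
    move=> p /G0A Ap; exists p => //; exists 0; rewrite !mulr0z.
    by case: p {Ap} => u v; congr pair; rewrite /= addr0.
  split.
  - by exists 0 => //; exists 0; rewrite !mulr0z; congr pair; rewrite /= addr0.
  - move=> _ _ [p Ap [k ->]] [q Aq [l ->]]; exists (p - q); first exact: AB.
    exists (k - l); rewrite !mulrzBr.
    by case: p q {Ap Aq} => p1 p2 [q1 q2]; congr pair; rewrite /= opprD addrACA.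
  - move=> y [[u v] Auv [k [e1 ->]]].
    have eu : u = b *~ (- k) by apply/eqP; rewrite mulrNz -addr_eq0 -e1.
    by rewrite eu in Auv; rewrite (dP _ _ Auv) mulrNz addNr.
have uniqA b d d' : A (b, d) -> A (b, d') -> d = d'.
  move=> Ad Ad'; apply/eqP; rewrite -subr_eq0; apply/eqP/Af.
  by have := AB _ _ Ad Ad'; rewrite -[(b, d) - _]/(b - b, d - d') subrr.
pose h b := sval (cid (total b)).
have hP b : A (b, h b) by rewrite /h; case: cid.
have hB : zmod_morphism h.
  by move=> x y; apply: uniqA (hP _) _; exact: AB (hP x) (hP y).
pose h' : {additive B -> D} := HB.pack h (GRing.isZmodMorphism.Build _ _ h hB).
exists h' => b d /G0A.
exact: uniqA.
Qed.

End DivisibleExtension.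


Section RatModZ.

Definition rat_int : rat -> bool := fun q => q \is a Num.int.

Lemma rat_int_closed : zmod_closed rat_int.
Proof. by split=> [|x y]; [exact: rpred0|exact: rpredB]. Qed.

Definition rat_int_zclosed : zmodClosed rat :=
  HB.pack rat_int (GRing.isZmodClosed.Build rat rat_int rat_int_closed).

Definition ratZ : zmodType := Quotient.quot rat_int_zclosed.

Definition to_ratZ (q : rat) : ratZ := \pi_(Quotient.quot rat_int_zclosed) q.

Lemma to_ratZ_zmod : zmod_morphism to_ratZ.
Proof. by move=> x y; rewrite /to_ratZ raddfB. Qed.
HB.instance Definition _ := GRing.isZmodMorphism.Build rat ratZ to_ratZ to_ratZ_zmod.

Lemma to_ratZ_eq0 q : (to_ratZ q == 0) = (q \is a Num.int).
Proof.
have -> : (0 : ratZ) = to_ratZ 0 by rewrite raddf0.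
by rewrite /to_ratZ -Quotient.idealrBE subr0.
Qed.

Lemma ratZ_divisible (n : nat) (y : ratZ) : (0 < n)%N -> exists d : ratZ, d *+ n = y.
Proof.
move=> n0; pose q := repr (y : Quotient.quot rat_int_zclosed).
exists (to_ratZ (q / n%:R)); rewrite -raddfMn /= -[_ *+ n]mulr_natr divfK.
  by rewrite /to_ratZ reprK.
by rewrite pnatr_eq0 -lt0n.
Qed.

Lemma half_nint (n : nat) : (1 < n)%N -> to_ratZ n%:R^-1 != 0.
Proof.
move=> n1; rewrite to_ratZ_eq0; apply/negP => /intrP[m em].
have n0 : (0 : rat) < n%:R by rewrite ltr0n (ltn_trans _ n1).
have m0 : (0 < m)%R by rewrite -(ltr0z rat) -em invr_gt0.
have : n%:R^-1 < 1 :> rat by rewrite invf_lt1 // ltr1n.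
by rewrite em -[1]/(1%:~R) ltr_int; case: m m0 {em} => // [[]].
Qed.

Lemma ratZ_cogenerates (M : zmodType) (x : M) : x != 0 ->
  exists h : {additive M -> ratZ}, h x != 0.
Proof.
move=> x0.
have [d d0 dP] : exists2 d : ratZ, d != 0 & forall k : int, x *~ k = 0 -> d *~ k = 0.
  have [exn|nexn] := pselect (exists n : nat, (0 < n)%N && (x *+ n == 0)).
    case: (ex_minnP exn) => n /andP[n0 /eqP xn] minn.
    have n1 : (1 < n)%N.
      by case: n n0 xn {minn} => [|[|n]] // _ /eqP; rewrite mulr1n (negPf x0).
    exists (to_ratZ n%:R^-1); first exact: half_nint.
    move=> k xk; have nz : n%:Z != 0 by case: (n) n0.
    have r0 : (k %% n)%Z = 0.
      apply/eqP; apply: contraT => rn0.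
      have rge := modz_ge0 k nz; have := ltz_pmod k (n0 : 0 < n%:Z).
      have : x *~ (k %% n)%Z = 0.
        move: xk; rewrite {1}(divz_eq k n) mulrzDr mulrC mulrzA.
        by rewrite -[x *~ n]/(x *+ n) xn mul0rz add0r.
      case: (k %% n)%Z rge rn0 => // r _ rn0 xr; rewrite ltz_nat ltnNge => /negP[].
      by apply: minn; rewrite -[x *+ r]/(x *~ r) xr eqxx andbT; case: (r) rn0.
    apply/eqP; rewrite -raddfMz to_ratZ_eq0 (divz_eq k n) r0 addr0 mulrC mulrzA.
    rewrite -[_ *~ n]/(_ *+ n) -[_ *+ n]mulr_natr mulVf ?intr_int //.
    by rewrite pnatr_eq0 -lt0n.
  exists (to_ratZ 2%:R^-1); first exact: half_nint.
  have pos (m : nat) : x *+ m = 0 -> m = 0%N.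
    case: m => // m xm; case: nexn; exists m.+1; by rewrite /= xm.
  case=> m; first by move=> /pos ->.
  by rewrite NegzE mulrNz => /eqP; rewrite oppr_eq0 => /eqP/pos.
have [|h hP] := @divisible_extension M ratZ ratZ_divisible
    [set p | exists k : int, p = (x *~ k, d *~ k)].
  split.
  - by exists 0; rewrite !mulr0z.
  - by move=> _ _ [k ->] [l ->]; exists (k - l); rewrite !mulrzBr.
  - by move=> y [k [/esym/dP dk ->]].
by exists h; rewrite (hP x d) //; exists 1; rewrite !mulr1z.
Qed.

End RatModZ.

Section Coinduced.
Context (R : pzRingType).

Definition add_pred : (R -> ratZ) -> bool := fun f => `[< zmod_morphism f >].

Lemma add_pred_closed : zmod_closed add_pred.
Proof.
split=> [|f g /asboolP fB /asboolP gB]; apply/asboolP => x y.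
  by rewrite -[RHS]/(0 - 0) subr0.
rewrite -[LHS]/(f (x - y) - g (x - y)) fB gB.
by rewrite -[RHS]/((f x - g x) - (f y - g y)) !opprD !opprK addrACA.
Qed.

Definition add_zclosed : zmodClosed (R -> ratZ) :=
  HB.pack add_pred (GRing.isZmodClosed.Build (R -> ratZ) add_pred add_pred_closed).

(** [Hom_Z(R, Q/Z)] with the action [(a *: f) s = f (s * a)]. *)
Record coind := Coind { coind_fun :> R -> ratZ; coind_funP : coind_fun \in add_zclosed }.
HB.instance Definition _ := [isSub for coind_fun].
HB.instance Definition _ := [Choice of coind by <:].
HB.instance Definition _ := [SubChoice_isSubZmodule of coind by <:].

Lemma coindB (f : coind) : zmod_morphism f.
Proof. exact/asboolP/(coind_funP f). Qed.

Lemma mk_coindP (f : R -> ratZ) : zmod_morphism f -> f \in add_zclosed.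
Proof. by move=> ?; apply/asboolP. Qed.

Fact cscale_subproof (a : R) (f : coind) : zmod_morphism (fun s => f (s * a)).
Proof. by move=> x y; rewrite mulrBl coindB. Qed.

Definition cscale a f := Coind (mk_coindP (cscale_subproof a f)).

Lemma coindP (f g : coind) : (forall s, f s = g s) -> f = g.
Proof. by move=> fg; apply: val_inj; apply/funext. Qed.

Lemma coindD (f g : coind) s : (f + g) s = f s + g s. Proof. by []. Qed.

Lemma coind_addr (f : coind) x y : f (x + y) = f x + f y.
Proof.
have f0 : f 0 = 0 by have := coindB f 0 0; rewrite !subrr.
have fN z : f (- z) = - f z by have := coindB f 0 z; rewrite f0 !sub0r.
by rewrite -[y]opprK coindB fN !opprK.
Qed.

Fact cscaleA a b f : cscale a (cscale b f) = cscale (a * b) f.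
Proof. by apply: coindP => s /=; rewrite mulrA. Qed.
Fact cscale1 : left_id 1 cscale.
Proof. by move=> f; apply: coindP => s /=; rewrite mulr1. Qed.
Fact cscaleDr : right_distributive cscale +%R.
Proof. by move=> a f g; apply: coindP. Qed.
Fact cscaleDl f : {morph cscale^~ f : a b / a + b}.
Proof. by move=> a b; apply: coindP => s /=; rewrite mulrDr coind_addr. Qed.

HB.instance Definition _ := GRing.Zmodule_isLmodule.Build R coind
  cscaleA cscale1 cscaleDr cscaleDl.

Lemma coind_injective : injective_module (coind : lmodType R).
Proof.
move=> A B i f ii.
have [|h hP] := @divisible_extension B ratZ ratZ_divisible
    [set p | exists a, p = (i a, f a 1)].
  split.
  - by exists 0; rewrite !linear0.
  - by move=> _ _ [a ->] [b ->]; exists (a - b); rewrite !linearB.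
  - by move=> y [a [/esym/eqP]]; rewrite raddf_eq0 // => /eqP -> ->; rewrite linear0.
have gadd b : zmod_morphism (fun s => h (s *: b)).
  by move=> x y; rewrite scalerBl raddfB.
pose g b := Coind (mk_coindP (gadd b)).
have glin : linear g.
  move=> a x y; apply: coindP => s /=.
  by rewrite scalerDr raddfD scalerA.
pose g' : {linear B -> coind} :=
  HB.pack g (GRing.isLinear.Build R B coind *:%R g glin).
exists g' => a.
apply: coindP => s /=; rewrite -linearZ (hP _ (f (s *: a) 1)); last by exists (s *: a).
by rewrite linearZ -[LHS]/(f a (1 * s)) mul1r.
Qed.

Lemma fct_injective (T : Type) (E : lmodType R) :
  injective_module E -> injective_module (T -> E : lmodType R).
Proof.
move=> Einj A B i f ii.
have flin t : linear (fun a => f a t) by move=> a x y; rewrite linearP.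
have ext t : exists g : {linear B -> E}, forall x, g (i x) = f x t.
  pose ft : {linear A -> E} :=
    HB.pack (fun a => f a t) (GRing.isLinear.Build R A E *:%R _ (flin t)).
  exact: (Einj _ _ i ft).
pose g b t := sval (cid (ext t)) b.
have glin : linear g by move=> a x y; apply/funext => t; rewrite /g linearP.
pose g' : {linear B -> (T -> E)} :=
  HB.pack g (GRing.isLinear.Build R B (T -> E) *:%R g glin).
exists g' => x /=.
by apply/funext => t; rewrite /g; case: cid.
Qed.

Theorem enough_injectives (M : lmodType R) :
  exists (E : lmodType R) (e : {linear M -> E}), injective_module E /\ injective e.
Proof.
pose E : lmodType R := {additive M -> ratZ} -> coind.
have eadd m (h : {additive M -> ratZ}) : zmod_morphism (fun s : R => h (s *: m)).
  by move=> x y; rewrite scalerBl raddfB.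
pose e m : E := fun h => Coind (mk_coindP (eadd m h)).
have elin : linear e.
  move=> a x y; apply/funext => h; apply: coindP => s /=.
  by rewrite scalerDr raddfD scalerA.
pose e' : {linear M -> E} := HB.pack e (GRing.isLinear.Build R M E *:%R e elin).
exists E, e'; split; first exact/fct_injective/coind_injective.
apply: raddf_inj => m em0; apply/eqP; apply: contraT => /ratZ_cogenerates[h].
have /(congr1 (fun f : coind => f 1)) : e' m h = 0 by rewrite em0.
by rewrite /= scale1r => ->; rewrite eqxx.
Qed.

End Coinduced.

Section StandardResolution.
Context (R : pzRingType) (M : lmodType R).

Lemma im_submod_set (V W : lmodType R) (f : {linear V -> W}) :
  submod_set [set y | exists x, f x = y].
Proof.
split=> /= [|a _ _ [x <-] [y <-]]; first by exists 0; rewrite linear0.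
by exists (a *: x + y); rewrite linearP.
Qed.

Definition im_submod (V W : lmodType R) (f : {linear V -> W}) : submodClosed W :=
  mk_submod (im_submod_set f).

(** Some injective module containing [N], not required to be minimal. *)
Definition inj_cont (N : lmodType R) : lmodType R := sval (cid (enough_injectives N)).

Definition inj_emb (N : lmodType R) : {linear N -> inj_cont N} :=
  sval (cid (svalP (cid (enough_injectives N)))).

Lemma inj_emb_spec (N : lmodType R) :
  injective_module (inj_cont N) /\ injective (inj_emb N).
Proof. exact: (svalP (cid (svalP (cid (enough_injectives N))))). Qed.

Fixpoint cosyzygy (n : nat) : lmodType R :=
  if n is n'.+1 then qmod (im_submod (inj_emb (cosyzygy n'))) else M.

Definition res_proj (n : nat) : {linear inj_cont (cosyzygy n) -> cosyzygy n.+1} :=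
  @qproj R (inj_cont (cosyzygy n)) (im_submod (inj_emb (cosyzygy n))).

Definition res_diff (n : nat) :
    {linear inj_cont (cosyzygy n) -> inj_cont (cosyzygy n.+1)} :=
  inj_emb (cosyzygy n.+1) \o res_proj n.

Lemma res_diff_eq0 n x :
  res_diff n x = 0 <-> exists u, inj_emb (cosyzygy n) u = x.
Proof.
have emb0 : forall u, inj_emb (cosyzygy n.+1) u = 0 -> u = 0.
  by move=> u u0; apply: (inj_emb_spec _).2; rewrite u0 linear0.
have proj0 : res_proj n x = 0 <-> x \in im_submod (inj_emb (cosyzygy n)).
  rewrite -(linear0 (res_proj n)).
  by split=> [/qproj_eqP|xi]; [|apply/qproj_eqP]; rewrite subr0.
split=> [/emb0/proj0/mk_submodP//|xi].
rewrite /= (_ : res_proj n x = 0) ?linear0 //.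
exact/proj0/mk_submodP.
Qed.

Lemma res_exact n x : res_diff n.+1 x = 0 <-> exists y, res_diff n y = x.
Proof.
rewrite res_diff_eq0; split=> [[u <-]|[y <-]]; last by exists (res_proj n y).
by have [y <-] := qproj_surj u; exists y.
Qed.

(** The injective resolution of [M] from which all right derived functors are
    computed; other injective resolutions give isomorphic modules. *)
Definition inj_res : injective_resolution M :=
  @InjRes R M (fun n => inj_cont (cosyzygy n)) res_diff (inj_emb M)
    (fun n => (inj_emb_spec (cosyzygy n)).1) (inj_emb_spec M).2
    (@res_diff_eq0 0) res_exact.

End StandardResolution.

Definition right_derived (R : pzRingType) (F : additive_functor R) (n : nat)
    (M : lmodType R) : lmodType R :=
  let E := inj_res M in
  if n is n'.+1 then homology (fmap F (ir_diff E n')) (fmap F (ir_diff E n'.+1))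
  else homology (\0 : {linear F (E 0) -> F (E 0)}) (fmap F (ir_diff E 0)).

Section Hom.
Context (R : comPzRingType).

Section HomModule.
Context (N X : lmodType R).

Lemma linear_submod_set : submod_set [set f : N -> X | linear f].
Proof.
split=> /= [a x y|b f g flin glin a x y]; first by rewrite /= scaler0 addr0.
rewrite -[LHS]/(b *: f (a *: x + y) + g (a *: x + y)) flin glin.
rewrite -[RHS]/(a *: (b *: f x + g x) + (b *: f y + g y)) !scalerDr.
by rewrite !scalerA [b * a]mulrC addrACA.
Qed.

Definition hom_module : lmodType R := submod (mk_submod linear_submod_set).

End HomModule.

Section HomMap.
Context (N A B : lmodType R) (f : {linear A -> B}).

Definition post_comp (h : N -> A) : N -> B := f \o h.

Lemma post_comp_linear : linear post_comp.
Proof. by move=> a g h; apply/funext => x; rewrite /post_comp /= linearP. Qed.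

HB.instance Definition _ :=
  GRing.isLinear.Build R (N -> A) (N -> B) *:%R post_comp post_comp_linear.

Lemma post_comp_hom (h : N -> A) : h \in mk_submod (linear_submod_set N A) ->
  post_comp h \in mk_submod (linear_submod_set N B).
Proof.
move=> /mk_submodP hlin; apply/mk_submodP => a x y.
by rewrite /post_comp /= hlin linearP.
Qed.

Definition hom_map : {linear hom_module N A -> hom_module N B} :=
  restr post_comp_hom.

End HomMap.

Definition hom_functor (N : lmodType R) : additive_functor R.
Proof.
exists (hom_module N) (@hom_map N).
- by move=> A h; apply: val_inj.
- by move=> A B C g f h; apply: val_inj.
- by move=> A B f g h; apply: val_inj.
Defined.

Definition Ext (n : nat) (N M : lmodType R) : lmodType R :=
  right_derived (hom_functor N) n M.

End Hom.

(** Ideals are the submodules of the regular module; the library's [idealr] is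
    not used because it excludes the unit ideal. *)
Notation ideal R := (submodClosed (R^o : lmodType R)).

Section Ideals.
Context (R : comPzRingType).
Implicit Types I J K : ideal R.

Definition quotient_by I : lmodType R := qmod I.

Lemma ideal_sum_set I J :
  @submod_set R R^o [set r | exists x y, [/\ x \in I, y \in J & r = x + y]].
Proof.
split=> /= [|c _ _ [x [y [xI yJ ->]]] [x' [y' [xI' yJ' ->]]]].
  by exists 0, 0; rewrite !rpred0 addr0.
exists (c *: x + x'), (c *: y + y'); rewrite !rpredD ?rpredZ //.
by rewrite scalerDr addrACA.
Qed.
Definition ideal_sum I J : ideal R := mk_submod (ideal_sum_set I J).

Lemma ideal_prod_set I J :
  @submod_set R R^o [set r | exists s : seq (R * R),
    (forall p, p \in s -> p.1 \in I /\ p.2 \in J) /\ r = \sum_(p <- s) p.1 * p.2].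
Proof.
split=> /= [|c _ _ [s [sP ->]] [s' [sP' ->]]].
  by exists [::]; rewrite big_nil.
exists ([seq (c * p.1, p.2) | p <- s] ++ s'); split.
  move=> p; rewrite mem_cat => /orP[/mapP[q qs ->]|/sP'//] /=.
  by have [q1 q2] := sP _ qs; split=> //; exact: (rpredZ c q1).
rewrite big_cat big_map /= -[c *: _]/(c * _) mulr_sumr.
by congr (_ + _); apply: eq_bigr => p _; rewrite mulrA.
Qed.
Definition ideal_prod I J : ideal R := mk_submod (ideal_prod_set I J).

Lemma ideal_unit_set : @submod_set R R^o [set: R]. Proof. by []. Qed.
Definition ideal_unit : ideal R := mk_submod ideal_unit_set.

Definition ideal_pow I (n : nat) : ideal R := iter n (ideal_prod I) ideal_unit.

Definition ideal_le I J : Prop := forall r, r \in I -> r \in J.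

Definition noetherian : Prop :=
  forall I, exists (n : nat) (g : 'I_n -> R),
    forall r, r \in I <-> exists c : 'I_n -> R, r = \sum_i c i * g i.

Definition Wtilde I J : set (ideal R) :=
  [set a : ideal R | exists n : nat, (1 <= n)%N /\ ideal_le (ideal_pow I n) (ideal_sum a J)].

Lemma ideal_prod_mem I J x y : x \in I -> y \in J -> x * y \in ideal_prod I J.
Proof.
move=> xI yJ; apply/mk_submodP; exists [:: (x, y)].
by split=> [p|]; rewrite ?big_seq1 // inE => /eqP ->.
Qed.

Lemma ideal_prod_min I J K :
  (forall x y, x \in I -> y \in J -> x * y \in K) -> ideal_le (ideal_prod I J) K.
Proof.
move=> IJK _ /mk_submodP[s [sP ->]]; rewrite big_seq.
by apply: (@rpred_sum _ K) => p /sP[p1 p2]; exact: IJK.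
Qed.

Lemma ideal_colon_set (K : ideal R) (p : R) : @submod_set R R^o [set r | p * r \in K].
Proof.
split=> /= [|c x y Kx Ky]; first by rewrite mulr0; exact: (@rpred0 _ K).
rewrite mulrDr -[c *: x]/(c * x) mulrCA; apply: (@rpredD _ K) => //.
exact: (@rpredZ R R^o K).
Qed.

Lemma ideal_powD_min I (n m : nat) K :
  (forall x y, x \in ideal_pow I n -> y \in ideal_pow I m -> x * y \in K) ->
  ideal_le (ideal_pow I (n + m)) K.
Proof.
elim: n K => [|n IH] K h r rI.
  by rewrite -[r]mul1r; apply: h => //; apply/mk_submodP.
apply: ideal_prod_min r rI => p r pI rI.
suff /mk_submodP : r \in mk_submod (ideal_colon_set K p) by [].
apply: IH r rI => x y xI yI; apply/mk_submodP; rewrite /= mulrA.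
by apply: h => //; exact: ideal_prod_mem.
Qed.

(** The set [I x]. *)
Definition ideal_orbit (X : lmodType R) I (x : X) : set X :=
  [set y | exists2 r, r \in I & y = r *: x].

Section PairTorsion.
Context (I J : ideal R) (X : lmodType R).

Definition pair_torsion : set X :=
  [set x | exists n : nat, (1 <= n)%N /\
    ideal_orbit (ideal_pow I n) x `<=` ideal_orbit J x].

Lemma orbit_transporter_set (x : X) :
  @submod_set R R^o [set r | ideal_orbit J x (r *: x)].
Proof.
split=> /= [|c r s [u uJ ru] [v vJ sv]].
  by rewrite scale0r; exists 0; rewrite ?scale0r //; exact: (@rpred0 _ J).
exists (c *: u + v); first by rewrite rpredD ?rpredZ.
by rewrite !scalerDl -!scalerA ru sv.
Qed.

Lemma pair_torsion_set : submod_set pair_torsion.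
Proof.
split=> /= [|a x y [n [n1 hx]] [m [m1 hy]]].
  exists 1; split=> // _ [r _ ->]; exists 0; rewrite ?scaler0 //.
  exact: (@rpred0 _ J).
exists (n + m)%N; split; first by rewrite (leq_trans n1) ?leq_addr.
move=> _ [r rI ->]; set z := a *: x + y.
suff /mk_submodP : r \in mk_submod (orbit_transporter_set z) by [].
apply: ideal_powD_min r rI => p q pI qI; apply/mk_submodP => /=.
have [s sJ px] : ideal_orbit J x (p *: x) by apply: hx; exists p.
have [u uJ qy] : ideal_orbit J y (q *: y) by apply: hy; exists q.
exists (p * u + s * (q - u)).
  apply: (@rpredD _ J); first exact: (@rpredZ R R^o J).
  by rewrite mulrC; exact: (@rpredZ R R^o J).
rewrite /z !scalerDr.
have -> : (p * q) *: (a *: x) = (q * a) *: (s *: x).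
  by rewrite -px !scalerA; congr (_ *: _); rewrite -mulrA mulrC.
have -> : (p * q) *: y = p *: (u *: y) by rewrite -qy scalerA.
have e1 : (p * u + s * (q - u)) *: (a *: x) = (q * a) *: (s *: x).
  have -> : p * u + s * (q - u) = (p - s) * u + q * s.
    by rewrite mulrBr mulrBl [s * q]mulrC addrA addrAC.
  have -> : ((p - s) * u + q * s) *: (a *: x) = (u * a) *: ((p - s) *: x) + (q * a) *: (s *: x).
    rewrite scalerDl !scalerA; congr (_ *: _ + _ *: _).
      by rewrite -mulrA mulrC.
    by rewrite -!mulrA [s * a]mulrC.
  by rewrite scalerBl px subrr scaler0 add0r.
have e2 : (p * u + s * (q - u)) *: y = p *: (u *: y).
  by rewrite scalerDl -[(s * _) *: y]scalerA scalerBl qy subrr scaler0 addr0 scalerA.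
by rewrite e1 e2.
Qed.

Definition gamma_obj : lmodType R := submod (mk_submod pair_torsion_set).

End PairTorsion.

Section PairTorsionMap.
Context (I J : ideal R) (A B : lmodType R) (f : {linear A -> B}).

Lemma pair_torsion_map x :
  x \in mk_submod (pair_torsion_set I J A) -> f x \in mk_submod (pair_torsion_set I J B).
Proof.
move=> /mk_submodP[n [n1 hx]]; apply/mk_submodP; exists n; split=> //.
move=> _ [r rI ->]; have [s sJ rs] : ideal_orbit J x (r *: x) by apply: hx; exists r.
by exists s; rewrite // -linearZ /= rs linearZ.
Qed.

Definition gamma_map : {linear gamma_obj I J A -> gamma_obj I J B} :=
  restr pair_torsion_map.

End PairTorsionMap.

Definition gamma_functor (I J : ideal R) : additive_functor R.
Proof.
exists (gamma_obj I J) (@gamma_map I J).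
- by move=> A x; apply: val_inj.
- by move=> A B C g f x; apply: val_inj.
- by move=> A B f g x; apply: val_inj.
Defined.

Definition local_cohomology (n : nat) (I J : ideal R) (M : lmodType R) : lmodType R :=
  right_derived (gamma_functor I J) n M.

Record serre_subcategory (S : lmodType R -> Prop) : Prop := {
  serre_zero : forall Z : lmodType R, (forall z : Z, z = 0) -> S Z;
  serre_iso : forall (A B : lmodType R) (f : {linear A -> B}),
    bijective f -> S A -> S B;
  serre_sub : forall (A B : lmodType R) (f : {linear A -> B}),
    injective f -> S B -> S A;
  serre_quot : forall (A B : lmodType R) (f : {linear A -> B}),
    (forall b, exists a, f a = b) -> S A -> S B;
  serre_ext : forall (A B C : lmodType R)
    (f : {linear A -> B}) (g : {linear B -> C}),
    injective f -> (forall c, exists b, g b = c) ->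
    (forall b, g b = 0 <-> exists a, f a = b) -> S A -> S C -> S B
}.

End Ideals.

(* Main.v *)
(* Let G be the image under Gamma_{I,J} of an injective resolution of M, with cycles Z^j,
   boundaries B^j and cohomology H^j = H^j_{I,J}(M). Every map R/a -> X lands in
   Gamma_{I,J}(X) because a is in W~(I,J), so Hom(R/a, G) computes Ext(R/a, M); and each
   G^j has no higher Ext from finitely generated modules. The sequences
   0 -> Z^j -> G^j -> B^(j+1) -> 0 and 0 -> B^j -> Z^j -> H^j -> 0 then give, by induction
   on j from B^0 = 0, that Ext^i(R/a, B^j) is in S for i + j = t + 1, i >= 1. Finally
   Hom(R/a, H^t) is an extension of a submodule of Ext^1(R/a, B^t) by a quotient of
   Ext^t(R/a, M). *)
Require Import Defs.
From HB Require Import structures.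
From mathcomp Require Import all_boot all_order all_algebra.
From mathcomp Require Import boolp classical_sets functions.

Set Implicit Arguments.
Unset Strict Implicit.
Unset Printing Implicit Defensive.

Import Order.TTheory GRing.Theory Num.Theory.
Local Open Scope ring_scope.
Local Open Scope classical_set_scope.

(** * Linear relations as partial maps, and factorization of linear maps *)

Section LinearRelations.
Context (R : pzRingType).
Implicit Types A B K P V W : lmodType R.

Definition mklin V W (f : V -> W) (hf : linear f) : {linear V -> W} :=
  HB.pack f (GRing.isLinear.Build R V W *:%R f hf).

Section UnbundledLinear.
Context (V W : lmodType R) (f : V -> W) (fl : linear f).

Lemma lin0 : f 0 = 0. Proof. exact: linear0 (mklin fl). Qed.
Lemma linD x y : f (x + y) = f x + f y. Proof. exact: linearD (mklin fl) x y. Qed.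
Lemma linB x y : f (x - y) = f x - f y. Proof. exact: linearB (mklin fl) x y. Qed.
Lemma linZ a x : f (a *: x) = a *: f x. Proof. by rewrite -[a *: x]addr0 fl lin0 addr0. Qed.

End UnbundledLinear.

Definition linrel V W (r : V -> W -> Prop) : Prop :=
  r 0 0 /\ forall a v v' w w', r v w -> r v' w' -> r (a *: v + v') (a *: w + w').

Lemma linrelB V W (r : V -> W -> Prop) v v' w w' :
  linrel r -> r v w -> r v' w' -> r (v - v') (w - w').
Proof.
move=> [_ rP] rv rv'; have := rP (-1) _ _ _ _ rv' rv.
by rewrite !scaleN1r ![- _ + _]addrC.
Qed.

Lemma submod_setB V (P : set V) x y : submod_set P -> P x -> P y -> P (x - y).
Proof.
by move=> [_ PP] Px Py; rewrite addrC -scaleN1r; apply: PP.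
Qed.

Lemma submod_setD V (P : set V) x y : submod_set P -> P x -> P y -> P (x + y).
Proof. by move=> [_ PP] Px Py; rewrite -[x]scale1r; apply: PP. Qed.

Lemma submod_setZ V (P : set V) a x : submod_set P -> P x -> P (a *: x).
Proof. by move=> [P0 PP] Px; rewrite -[_ *: _]addr0; apply: PP. Qed.

Lemma qproj_eq0 V (S : submodClosed V) x : qproj S x = 0 <-> x \in S.
Proof.
rewrite -(linear0 (qproj S)).
by split=> [/qproj_eqP|xS]; [|apply/qproj_eqP]; rewrite subr0.
Qed.

(** Two values at the same [v] differ by a value at 0, so single-valuedness need only be tested
    there. *)
Lemma linrel_fun V W (r : V -> W -> Prop) :
  linrel r -> (forall v, exists w, r v w) -> (forall w, r 0 w -> w = 0) ->
  exists f : {linear V -> W}, forall v, r v (f v).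
Proof.
move=> rlin rtot r0.
have runiq v w w' : r v w -> r v w' -> w = w'.
  move=> rw rw'; apply/eqP; rewrite -subr_eq0; apply/eqP/r0.
  by rewrite -(subrr v); apply: linrelB.
pose f v := sval (cid (rtot v)).
have fP v : r v (f v) by rewrite /f; case: cid.
have flin : linear f.
  by move=> a x y; apply: runiq (fP _) _; apply: rlin.2.
by exists (mklin flin).
Qed.

Lemma factor_surj P K V (p : {linear P -> K}) (h : P -> V) : linear h ->
  (forall k, exists x, p x = k) -> (forall x, p x = 0 -> h x = 0) ->
  exists2 g : K -> V, linear g & forall x, g (p x) = h x.
Proof.
move=> hl ps p0.
have [||v|g gP] := @linrel_fun K V (fun k v => exists2 x, p x = k & h x = v).
- split; first by exists 0; rewrite ?linear0 ?(lin0 hl).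
  move=> a _ _ _ _ [x <- <-] [y <- <-]; exists (a *: x + y); last exact: hl.
  exact: linearP.
- by move=> k; have [x px] := ps k; exists (h x), x.
- by move=> [x /p0 <- <-].
exists g => [|x]; first exact: linearP.
have [y pxy <-] := gP (p x); apply/eqP; rewrite -subr_eq0 -(linB hl).
by apply/eqP/p0; rewrite linearB pxy subrr.
Qed.

Lemma factor_inj P V W (i : {linear V -> W}) (h : P -> W) : linear h ->
  injective i -> (forall x, exists v, i v = h x) ->
  exists2 g : P -> V, linear g & forall x, i (g x) = h x.
Proof.
move=> hl ii ih.
have [|//|v|g gP] := @linrel_fun P V (fun x v => i v = h x).
- split=> [|a x y v w iv iw]; first by rewrite linear0 (lin0 hl).
  by rewrite linearP iv iw hl.
- by rewrite (lin0 hl) => iv; apply: ii; rewrite iv linear0.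
by exists g => //; exact: linearP.
Qed.

Lemma factor_submod P V (S : submodClosed V) (h : P -> V) : linear h ->
  (forall x, h x \in S) -> exists g : {linear P -> submod S}, forall x, val (g x) = h x.
Proof.
move=> hl hS; pose g x := Submod (hS x).
have gl : linear g by move=> a x y; apply: val_inj; exact: hl.
by exists (mklin gl).
Qed.

(** On its domain, a submodule, [r] is a linear map, which injectivity of [E] extends along the
    inclusion. This extends a map from a sum of submodules without first building it as a function
    there. *)
Lemma injective_module_linrel (E : lmodType R) V (r : V -> E -> Prop) :
  injective_module E -> linrel r -> (forall e, r 0 e -> e = 0) ->
  exists2 f : V -> E, linear f & forall v e, r v e -> f v = e.
Proof.
move=> Einj rlin r0.
have Dset : submod_set [set v | exists e, r v e].
  split=> /= [|a v w [e re] [e' re']]; first by exists 0; exact: rlin.1.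
  by exists (a *: e + e'); exact: rlin.2.
have [||e|f0 f0P] := @linrel_fun (submod (mk_submod Dset)) E (fun v e => r (val v) e).
- by split; [exact: rlin.1|move=> a v v' w w'; exact: rlin.2].
- by move=> [v vD]; have /mk_submodP := vD.
- exact: r0.
have [f fP] := Einj _ _ (val : {linear submod (mk_submod Dset) -> V}) f0 val_inj.
exists f; first exact: linearP.
move=> v e re; have vD : v \in mk_submod Dset by apply/mk_submodP; exists e.
have := fP (Submod vD) => /= ->; apply/eqP; rewrite -subr_eq0; apply/eqP/r0.
by rewrite -(subrr v); apply: linrelB => //; exact: (f0P (Submod vD)).
Qed.

End LinearRelations.

(** * Subquotients of objects of a Serre subcategory *)

Section Small.
Context (R : comPzRingType) (Serre : lmodType R -> Prop).
Context (serreS : serre_subcategory Serre).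
Implicit Types V W : lmodType R.

(* "The quotient of [P] by [P] cap [Q] is a subquotient of an object of [Serre]".
   Since the comparison is an arbitrary linear relation, connecting homomorphisms
   need not be constructed as maps. *)
Definition small V (P Q : set V) : Prop :=
  exists A : lmodType R, Serre A /\ exists r : V -> A -> Prop,
    [/\ linrel r, forall v, P v -> exists a, r v a & forall v, P v -> r v 0 -> Q v].

(** The witness for [P'] and [Q'] is composed with [r]. Most comparisons of Ext modules below are
    instances, with [r] in the role of a connecting or comparison map. *)
Lemma small_rel V W (P Q : set V) (P' Q' : set W) (r : V -> W -> Prop) :
  submod_set P' -> linrel r ->
  (forall v, P v -> exists2 w, P' w & r v w) ->
  (forall v w, P v -> P' w -> r v w -> Q' w -> Q v) ->
  small P' Q' -> small P Q.
Proof.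
move=> P'sub rlin rtot rQ [A [SA [s [slin stot sQ]]]].
exists A; split=> //; exists (fun v a => exists w, [/\ P' w, r v w & s w a]).
split.
- split; first by exists 0; split; [exact: P'sub.1|exact: rlin.1|exact: slin.1].
  move=> a v v' x x' [w [Pw rw sw]] [w' [Pw' rw' sw']].
  by exists (a *: w + w'); split; [exact: P'sub.2|exact: rlin.2|exact: slin.2].
- move=> v /rtot[w Pw rw]; have [a sa] := stot _ Pw.
  by exists a, w.
- by move=> v Pv [w [Pw rw sw]]; apply: (rQ _ w) => //; exact: sQ.
Qed.

Lemma small_sub V (P Q P' Q' : set V) : submod_set P' ->
  P `<=` P' -> (P `&` Q') `<=` Q -> small P' Q' -> small P Q.
Proof.
move=> P'sub PP' QQ'; apply: (@small_rel _ _ _ _ _ _ (fun v w => v = w)) => //.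
- by split=> // a v v' w w' -> ->.
- by move=> v Pv; exists v => //; exact: PP'.
- by move=> v w Pv _ <- Qv; exact: QQ'.
Qed.

(** Read backwards, the relation is single-valued, since only 0 is related to 0; so [V] is a
    quotient of the submodule of [A] that the relation reaches. *)
Lemma serre_small V : small (@setT V) [set 0] -> Serre V.
Proof.
move=> [A [SA [r [rlin rtot r0]]]].
have Aset : submod_set [set a | exists v, r v a].
  split=> /= [|a x y [v rv] [w rw]]; first by exists 0; exact: rlin.1.
  by exists (a *: v + w); exact: rlin.2.
have SB : Serre (submod (mk_submod Aset)).
  exact: (serre_sub serreS (f := val : {linear submod (mk_submod Aset) -> A}) val_inj).
have [||v|f fP] := @linrel_fun R (submod (mk_submod Aset)) V (fun a v => r v (val a)).
- by split; [exact: rlin.1|move=> a v v' w w'; exact: rlin.2].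
- by move=> [a aD]; have /mk_submodP := aD.
- exact: r0.
apply: (serre_quot serreS (f := f)) SB => v; have [a ra] := rtot v I.
have aD : a \in mk_submod Aset by apply/mk_submodP; exists v.
exists (Submod aD); apply/eqP; rewrite -subr_eq0; apply/eqP/r0 => //.
by rewrite -(subrr a); apply: linrelB => //; exact: (fP (Submod aD)).
Qed.

Lemma small_homology (U V W : lmodType R) (f : {linear U -> V}) (g : {linear V -> W}) :
  Serre (homology f g) -> small [set v | g v = 0] [set v | exists u, f u = v].
Proof.
move=> SH; exists (homology f g); split=> //.
exists (fun v h => exists2 u : submod (kernel g), val u = v & qproj (image_in f (kernel g)) u = h).
split.
- split; first by exists 0; rewrite ?linear0.
  by move=> a _ _ _ _ [u <- <-] [u' <- <-]; exists (a *: u + u'); rewrite linearP.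
- move=> v gv; have vK : v \in kernel g by apply/mk_submodP.
  by exists (qproj (image_in f (kernel g)) (Submod vK)), (Submod vK).
- by move=> v _ [u <-] /qproj_eq0/mk_submodP.
Qed.

(** Let X be P modulo the intersection of P and Q, and Y the image in X of the intersection of P and
    M. By [serre_small], the second smallness hypothesis puts Y in [Serre] and the first puts X/Y
    there; X is an extension of X/Y by Y. *)
Lemma small_ext V (P M Q : set V) :
  submod_set P -> submod_set M -> submod_set Q ->
  small P M -> small (P `&` M) Q -> small P Q.
Proof.
move=> Ps Ms Qs [A [SA [r [rlin rtot rM]]]] [B [SB [s [slin stot sQ]]]].
pose U := submod (mk_submod Ps).
have Qs' : submod_set [set u : U | Q (val u)].
  by split; [exact: Qs.1|move=> a x y; exact: Qs.2].
pose X : lmodType R := qmod (mk_submod Qs').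
pose q : {linear U -> X} := qproj (mk_submod Qs').
have q0 u : q u = 0 -> Q (val u) by move=> /qproj_eq0/mk_submodP.
have UP (u : U) : P (val u) by case: u => v vP; apply/mk_submodP.
have Ys : submod_set [set x : X | exists2 u, M (val u) & q u = x].
  split; first by exists 0; [exact: Ms.1|exact: linear0].
  move=> a _ _ [u Mu <-] [v Mv <-]; exists (a *: u + v); last exact: linearP.
  exact: Ms.2.
suff SX : Serre X.
  exists X; split=> //; exists (fun v x => exists2 u, val u = v & q u = x); split.
  - split; first by exists 0; rewrite ?linear0.
    by move=> a _ _ _ _ [u <- <-] [u' <- <-]; exists (a *: u + u'); rewrite linearP.
  - move=> v Pv; have vP : v \in mk_submod Ps by apply/mk_submodP.
    by exists (q (Submod vP)), (Submod vP).
  - by move=> v Pv [u <- /q0].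
pose Y := submod (mk_submod Ys).
have SY : Serre Y.
  apply: serre_small; exists B; split=> //.
  exists (fun y b => exists u : U, [/\ q u = val y, M (val u) & s (val u) b]); split.
  - split; first by exists 0; rewrite ?linear0; split=> //; [exact: Ms.1|exact: slin.1].
    move=> a y y' b b' [u [uy Mu su]] [u' [uy' Mu' su']]; exists (a *: u + u').
    by rewrite linearP uy uy'; split=> //; [exact: Ms.2|exact: slin.2].
  - move=> [y yY] _; have /mk_submodP[u Mu uy] := yY.
    by have [b sb] := stot _ (conj (UP u) Mu); exists b, u.
  - move=> y _ [u [uy Mu su]]; apply: val_inj; rewrite -uy.
    by apply/qproj_eq0/mk_submodP/sQ.
have SXY : Serre (qmod (mk_submod Ys)).
  apply: serre_small; exists A; split=> //.
  exists (fun z a => exists u : U, qproj (mk_submod Ys) (q u) = z /\ r (val u) a); split.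
  - split; first by exists 0; rewrite !linear0; split=> //; exact: rlin.1.
    move=> a y y' b b' [u [<- su]] [u' [<- su']]; exists (a *: u + u').
    by rewrite !linearP; split=> //; exact: rlin.2.
  - move=> z _; have [x <-] := qproj_surj z; have [u <-] := qproj_surj x.
    by have [a ra] := rtot _ (UP u); exists a, u.
  - move=> z _ [u [<- ru]]; apply/qproj_eq0/mk_submodP.
    by exists u => //; exact: rM.
apply: (serre_ext serreS (f := val : {linear Y -> X}) (g := qproj (mk_submod Ys))
  val_inj) SY SXY => [c|x]; first exact: qproj_surj.
split=> [/qproj_eq0 xY|[[y yY] <-]]; first by exists (Submod xY).
exact/qproj_eq0.
Qed.

End Small.

(** * Noetherian modules and finite free covers *)

Section NoetherianModules.
Context (R : pzRingType).
Implicit Types A B C V W : lmodType R.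

(** The recursion follows the list, so that spanning sets are mapped, lifted and concatenated by
    induction, without indexed sums. *)
Fixpoint spanned V (s : seq V) (x : V) : Prop :=
  if s is g :: s' then exists c : R, spanned s' (x - c *: g) else x = 0.

Definition noeth V : Prop := forall P : set V, submod_set P ->
  exists2 s : seq V, (forall x, x \in s -> P x) & forall x, P x -> spanned s x.

Lemma spanned_sub V (P : set V) s x :
  submod_set P -> (forall y, y \in s -> P y) -> spanned s x -> P x.
Proof.
move=> Ps; elim: s x => [|g s IH] x sP /=; first by move=> ->; exact: Ps.1.
move=> [c xs]; rewrite -[x](subrK (c *: g)) addrC; apply: Ps.2.
  by apply: sP; rewrite inE eqxx.
by apply: IH xs => y ys; apply: sP; rewrite inE ys orbT.
Qed.

Lemma spanned_map V W (f : {linear V -> W}) s x : spanned s x -> spanned (map f s) (f x).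
Proof.
elim: s x => [|g s IH] x /=; first by move=> ->; rewrite linear0.
by move=> [c xs]; exists c; rewrite -linearZ -linearB; exact: IH.
Qed.

Lemma spanned_lift V W (f : {linear V -> W}) s x :
  spanned (map f s) (f x) -> exists2 k, f k = 0 & spanned s (x - k).
Proof.
elim: s x => [|g s IH] x /=; first by exists x; rewrite // subrr.
move=> [c]; rewrite -linearZ -linearB => /IH[k fk xs].
by exists k => //; exists c; rewrite addrAC.
Qed.

Lemma spanned_cat V (s t : seq V) x k :
  spanned s (x - k) -> spanned t k -> spanned (s ++ t) x.
Proof.
elim: s x => [|g s IH] x /=; first by move=> /eqP; rewrite subr_eq0 => /eqP ->.
by move=> [c xs] tk; exists c; apply: IH tk; rewrite addrAC.
Qed.

Lemma seq_lift (T U : eqType) (f : T -> U) (P : T -> Prop) (s : seq U) :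
  (forall u, u \in s -> exists2 x, P x & f x = u) ->
  exists2 s', (forall x, x \in s' -> P x) & map f s' = s.
Proof.
elim: s => [|u s IH] sP; first by exists [::].
have [|s' s'P <-] := IH; first by move=> v vs; apply: sP; rewrite inE vs orbT.
have [|x Px <-] := sP u; first by rewrite inE eqxx.
exists (x :: s') => // y; rewrite inE => /orP[/eqP ->//|]; exact: s'P.
Qed.

(** Generators of [P] are lifts of generators of f(P), followed by images of generators of the
    preimage of [P] under [i]. *)
Lemma noeth_ses A B C (i : {linear A -> B}) (f : {linear B -> C}) :
  (forall b, f b = 0 -> exists a, i a = b) -> noeth A -> noeth C -> noeth B.
Proof.
move=> exf nA nC P Ps.
have fPs : submod_set [set c | exists2 b, P b & f b = c].
  split; first by exists 0; [exact: Ps.1|rewrite linear0].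
  move=> a _ _ [x Px <-] [y Py <-]; exists (a *: x + y); last exact: linearP.
  exact: Ps.2.
have iPs : submod_set [set a | P (i a)].
  split=> /= [|a x y Px Py]; first by rewrite linear0; exact: Ps.1.
  by rewrite linearP; exact: Ps.2.
have [s0 s0P s0sp] := nC _ fPs; have [t tP tsp] := nA _ iPs.
have [s sP es] := seq_lift s0P.
exists (s ++ map i t) => [x|x Px].
  by rewrite mem_cat => /orP[/sP//|/mapP[a /tP Pa ->]].
have : spanned s0 (f x) by apply: s0sp; exists x.
rewrite -es => /spanned_lift[k fk xs]; apply: spanned_cat (xs) _.
have [a ak] := exf _ fk; rewrite -ak; apply/spanned_map/tsp; rewrite /= ak.
rewrite -[k](subKr x); apply: submod_setB => //.
by apply: spanned_sub xs.
Qed.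

Lemma noeth_inj B C (f : {linear B -> C}) : injective f -> noeth C -> noeth B.
Proof.
(* The kernel of [f] is zero, so the zero map out of any noetherian module covers it; [C] is one at
   hand. *)
move=> fi nC; apply: (noeth_ses (i := \0 : {linear C -> B}) (f := f)) => // b fb.
by exists 0; apply: fi; rewrite fb !linear0.
Qed.

Lemma noeth_surj A B (f : {linear A -> B}) :
  (forall b, exists a, f a = b) -> noeth A -> noeth B.
Proof.
move=> fs nA P Ps.
have [|s sP ssp] := nA [set a | P (f a)].
  split=> /= [|a x y Px Py]; first by rewrite linear0; exact: Ps.1.
  by rewrite linearP; exact: Ps.2.
exists (map f s) => [_ /mapP[a /sP Pa ->]//|b Pb].
by have [a ab] := fs b; rewrite -ab; apply/spanned_map/ssp; rewrite /= ab.
Qed.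

Lemma noeth_prod A B : noeth A -> noeth B -> noeth (A * B)%type.
Proof.
have il : linear (fun a : A => (a, 0) : A * B).
  by move=> a x y; congr pair; rewrite /= scaler0 addr0.
apply: (@noeth_ses A (A * B)%type B (mklin il) snd) => -[a b] /= ->.
by exists a.
Qed.

(** The union of the chain is finitely generated, and its generators all lie in one [F n]. *)
Lemma noeth_acc V (F : nat -> set V) : noeth V ->
  (forall n, submod_set (F n)) -> (forall n, F n `<=` F n.+1) ->
  exists n, F n.+1 `<=` F n.
Proof.
move=> nV Fs Fi.
have Fmono m n : (m <= n)%N -> F m `<=` F n.
  elim: n => [|n IH]; first by rewrite leqn0 => /eqP ->.
  by rewrite leq_eqVlt => /orP[/eqP ->//|/IH mn]; apply: subset_trans mn _.
have [|s sP ssp] := nV [set x | exists n, F n x].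
  split=> /= [|a x y [m Fx] [n Fy]]; first by exists 0%N; exact: (Fs _).1.
  exists (maxn m n); apply: (Fs _).2.
    by apply: Fmono Fx; rewrite leq_maxl.
  by apply: Fmono Fy; rewrite leq_maxr.
have [n sn] : exists n, forall x, x \in s -> F n x.
  elim: s sP {ssp} => [|x s IH] sP; first by exists 0%N.
  have [|n sn] := IH; first by move=> y ys; apply: sP; rewrite inE ys orbT.
  have [|m Fx] := sP x; first by rewrite inE eqxx.
  exists (maxn m n) => y; rewrite inE => /orP[/eqP ->|/sn ys].
    by apply: Fmono Fx; rewrite leq_maxl.
  by apply: Fmono ys; rewrite leq_maxr.
exists n => x Fx; apply: spanned_sub (Fs n) sn _.
by apply: ssp; exists n.+1.
Qed.

(** Without a maximal member, choice would produce a strictly ascending sequence in [Phi], against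
    [noeth_acc]. *)
Lemma noeth_max V (Phi : set (set V)) (P0 : set V) : noeth V ->
  (forall P, Phi P -> submod_set P) -> Phi P0 ->
  exists2 P, Phi P & forall P', Phi P' -> P `<=` P' -> P' `<=` P.
Proof.
move=> nV Phis PhiP0; apply: contrapT => nomax.
have grow (P : {P | Phi P}) : exists P' : {P | Phi P}, sval P `<=` sval P' /\ ~ sval P' `<=` sval P.
  apply: contrapT => nP; apply: nomax; exists (sval P); first exact: svalP.
  move=> P' PhiP' PP'; apply: contrapT => nP'P; apply: nP.
  by exists (exist _ P' PhiP').
pose next P := sval (cid (grow P)).
pose F n := iter n next (exist _ P0 PhiP0).
have [n|n|n] := @noeth_acc V (fun n => sval (F n)) nV.
- exact/Phis/(svalP (F n)).
- by rewrite /F /= /next; case: cid => ? [].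
- by rewrite /F /= /next; case: cid => ? [].
Qed.

Definition projective (P : lmodType R) : Prop :=
  forall A B (p : {linear A -> B}) (f : P -> B), linear f ->
  (forall b, exists a, p a = b) -> exists2 g : P -> A, linear g & forall x, p (g x) = f x.

Lemma projective_regular : projective (R^o : lmodType R).
Proof.
move=> A B p f fl ps; have [a pa] := ps (f 1).
exists (fun r => r *: a) => [c x y|x]; first by rewrite scalerDl scalerA.
by rewrite linearZ /= pa -(linZ fl); congr f; exact: mulr1.
Qed.

Lemma projective_prod (P Q : lmodType R) : projective P -> projective Q -> projective (P * Q)%type.
Proof.
move=> pP pQ A B p f fl ps.
have [|//|g gl gP] := pP A B p (fun x => f (x, 0)).
  move=> a x y; rewrite -fl; congr f; congr pair.
  by rewrite /= scaler0 addr0.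
have [|//|h hl hP] := pQ A B p (fun x => f (0, x)).
  move=> a x y; rewrite -fl; congr f; congr pair.
  by rewrite /= scaler0 addr0.
exists (fun x => g x.1 + h x.2) => [a x y|[x y]].
  by rewrite gl hl scalerDr addrACA.
rewrite linearD gP hP -(linD fl); congr f; congr pair; rewrite /= ?addr0 ?add0r //.
Qed.

(** A finite free module does it, growing by one copy of R per generator; the cover is not meant to
    be minimal. *)
Lemma projective_cover V : noeth (R^o : lmodType R) -> noeth V ->
  exists (P : lmodType R) (p : {linear P -> V}),
    [/\ projective P, noeth P & forall v, exists x, p x = v].
Proof.
move=> nR nV; have [|s _ ssp] := nV setT; first by split.
suff [P [p [pP nP ps]]] : exists (P : lmodType R) (p : {linear P -> V}),
    [/\ projective P, noeth P & forall v, spanned s v -> exists x, p x = v].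
  by exists P, p; split=> // v; apply/ps/ssp.
elim: s {ssp} => [|g s [P [p [pP nP ps]]]].
  (* The empty list spans only 0, so [R^o] with the zero map can start the induction. *)
  exists R^o, (\0 : {linear R^o -> V}); split=> // [|v /= ->]; last by exists 0.
  exact: projective_regular.
have ql : linear (fun x : R^o * P => (x.1 : R) *: g + p x.2).
  by move=> a x y; rewrite /= scalerDl linearP scalerDr scalerA addrACA.
exists (R^o * P)%type, (mklin ql); split.
- exact: projective_prod projective_regular pP.
- exact: noeth_prod.
- move=> v /= [c /ps[x px]]; exists (c, x) => /=.
  by rewrite px addrC subrK.
Qed.

End NoetherianModules.

(** * Sets of linear maps that present Ext^1 *)

Section LinearMaps.
Context (R : comPzRingType).
Implicit Types A B C K P X : lmodType R.

Definition lin_maps K X : set (K -> X) := [set f | linear f].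

Lemma lin_maps_submod K X : submod_set (@lin_maps K X).
Proof. exact: linear_submod_set. Qed.

Lemma lin_comp A B C (g : B -> C) (f : A -> B) :
  linear f -> linear g -> linear (fun x => g (f x)).
Proof. by move=> fl gl a x y; rewrite fl gl. Qed.

(** For [P] projective and [p] surjective, Hom(ker p, X) modulo these maps is Ext^1(K, X). *)
Definition extendable P K (p : {linear P -> K}) X : set (submod (kernel p) -> X) :=
  [set f | exists2 g : P -> X, linear g & forall u, g (val u) = f u].

Lemma extendable_submod P K (p : {linear P -> K}) X : submod_set (@extendable _ _ p X).
Proof.
split; first by exists (fun=> 0) => // a x y; rewrite scaler0 addr0.
move=> a f f' [g gl gf] [g' gl' gf']; exists (a *: g + g').
  exact: (lin_maps_submod _ _).2.
by move=> u; rewrite -[LHS]/(a *: g (val u) + g' (val u)) gf gf'.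
Qed.

(** For [q] surjective with kernel A, Hom(K, C) modulo these maps embeds in Ext^1(K, A), and equals
    it when [B] is injective. *)
Definition liftable K B C (q : {linear B -> C}) : set (K -> C) :=
  [set f | exists2 g : K -> B, linear g & forall k, q (g k) = f k].

Lemma liftable_submod K B C (q : {linear B -> C}) : submod_set (@liftable K _ _ q).
Proof.
split; first by exists (fun=> 0) => [a x y|k]; rewrite ?scaler0 ?addr0 ?linear0.
move=> a f f' [g gl gf] [g' gl' gf']; exists (a *: g + g').
  exact: (lin_maps_submod _ _).2.
by move=> u; rewrite -[X in q X]/(a *: g u + g' u) linearP gf gf'.
Qed.

End LinearMaps.

Arguments lin_maps [R] K X _.
Arguments extendable [R P K] p X _.
Arguments liftable [R] K [B C] q _.

(** * Dimension shifting for Ext through syzygies of the first variable *)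

Section ExtDimensionShift.
Context (R : comPzRingType) (Serre : lmodType R -> Prop).
Context (serreS : serre_subcategory Serre).
Implicit Types A B C K P X : lmodType R.
Local Notation small := (small Serre).

(* [ext_small n K X] stands for "Ext^(n+1)(K, X) is in Serre"; it shifts dimensions
   in the first variable, so that no resolution of [X] is involved. *)
Fixpoint ext_small (n : nat) K X : Prop :=
  forall P (p : {linear P -> K}), projective P -> noeth P ->
  (forall k, exists x, p x = k) ->
  if n is n'.+1 then ext_small n' (submod (kernel p)) X
  else small (lin_maps (submod (kernel p)) X) (extendable p X).

Lemma kernelP P K (p : {linear P -> K}) (u : submod (kernel p)) : p (val u) = 0.
Proof. by case: u => x xk; have /mk_submodP := xk. Qed.

Lemma kernel_sub P K (p : {linear P -> K}) x :
  p x = 0 -> exists u : submod (kernel p), val u = x.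
Proof. by move=> px; have xk : x \in kernel p by [apply/mk_submodP]; exists (Submod xk). Qed.

Lemma noeth_submod P (S : submodClosed P) : noeth P -> noeth (submod S).
Proof. exact: (noeth_inj (f := val : {linear submod S -> P}) val_inj). Qed.

(** Exactness of Ext^(n+1)(K, -) at the middle term. Passing to a syzygy of [K] lowers n, so only
    Ext^1 takes work. *)
Lemma ext_small_middle n K A B C (i : {linear A -> B}) (q : {linear B -> C}) :
  injective i -> (forall c, exists b, q b = c) ->
  (forall b, q b = 0 <-> exists a, i a = b) ->
  ext_small n K A -> ext_small n K C -> ext_small n K B.
Proof.
move=> ii qs iq; elim: n K => [|n IH] K /= sA sC P p pP nP ps; last first.
  by apply: IH; [exact: sA|exact: sC].
pose L := submod (kernel p).
(* [M] filters Hom(L, B): maps modulo [M] are detected in Ext^1(K, C), and [M] modulo the extendable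
   maps in Ext^1(K, A). *)
pose M : set (L -> B) := [set f | extendable p C (fun u => q (f u))].
have Ms : submod_set M.
  split; first by exists (fun=> 0) => [a x y|u]; rewrite ?scaler0 ?addr0 ?linear0.
  move=> a f f' fM fM'; have := (extendable_submod p C).2 a _ _ fM fM'.
  rewrite /M /=; congr (extendable _); apply/funext => u.
  by rewrite -[RHS]/(q (a *: f u + f' u)) linearP.
apply: (small_ext serreS (M := M)) => //.
- exact: lin_maps_submod.
- exact: extendable_submod.
- have := sC _ _ pP nP ps; apply: (@small_rel _ _ _ _ _ _ _ _ (fun f g => g = (fun u => q (f u)))).
  + exact: lin_maps_submod.
  + split=> [|a f f' _ _ -> ->]; first by apply/funext => u; rewrite linear0.
    by apply/funext => u; rewrite -[RHS]/(q (a *: f u + f' u)) linearP.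
  + move=> f fl; exists (fun u => q (f u)) => //; apply: lin_comp => //.
    exact: linearP.
  + by move=> f _ _ _ ->.
(* If q f extends to P, projectivity lifts the extension to [g : P -> B]; then f - g on L falls into
   A and gives [a]. If [a] extends to P, so does f = i a + g. *)
- have := sA _ _ pP nP ps; apply: (@small_rel _ _ _ _ _ _ _ _ (fun f a =>
    exists2 g : P -> B, linear g & forall u, f u - g (val u) = i (a u))).
  + exact: lin_maps_submod.
  + split.
      exists (fun=> 0) => [a x y|u]; first by rewrite scaler0 addr0.
      by rewrite subr0 -[RHS]/(i 0) linear0.
    move=> c f f' a a' [g gl gP] [g' gl' gP']; exists (c *: g + g').
      exact: (lin_maps_submod _ _).2.
    move=> u; rewrite -[LHS]/(c *: f u + f' u - (c *: g (val u) + g' (val u))).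
    rewrite -[X in _ = i X]/(c *: a u + a' u) linearP -gP -gP' scalerBr opprD.
    by rewrite addrACA.
  + move=> f [fl [g0 gl0 gP0]].
    have [g gl gP] := pP B C q g0 gl0 qs.
    have hl : linear (fun u : L => f u - g (val u)).
      by move=> a x y; rewrite fl linearP gl scalerBr opprD addrACA.
    have [u|a al aP] := factor_inj hl ii.
      by apply/iq; rewrite linearB gP gP0 subrr.
    by exists a => //; exists g.
  + move=> f a [fl _] al [g gl gP] [a' al' aP'].
    exists (fun x => i (a' x) + g x) => [c x y|u].
      by rewrite al' gl linearP scalerDr addrACA.
    by rewrite aP' -gP subrK.
Qed.

(** The connecting map Hom(K, C) -> Ext^1(K, A) has the liftable maps as its kernel. As a relation,
    it links [f] to [a] when some [h : P -> B] lifts f p and restricts to i a on ker p. *)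
Lemma hom_liftable_small K A B C (i : {linear A -> B}) (q : {linear B -> C}) :
  noeth (R^o : lmodType R) -> noeth K -> injective i ->
  (forall c, exists b, q b = c) -> (forall b, q b = 0 <-> exists a, i a = b) ->
  ext_small 0 K A -> small (lin_maps K C) (liftable K q).
Proof.
move=> nR nK ii qs iq sA; have [P [p [pP nP ps]]] := projective_cover nR nK.
have := sA _ _ pP nP ps.
apply: (@small_rel _ _ _ _ _ _ _ _ (fun f a => exists h : P -> B,
  [/\ linear h, forall x, q (h x) = f (p x) & forall u, h (val u) = i (a u)])).
- exact: lin_maps_submod.
- split; first by exists (fun=> 0); split=> [a x y|x|u]; rewrite ?scaler0 ?addr0 ?linear0.
  move=> c f f' a a' [h [hl hf ha]] [h' [hl' hf' ha']]; exists (c *: h + h').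
  split=> [|x|x]; first exact: (lin_maps_submod _ _).2.
    by rewrite -[X in q X]/(c *: h x + h' x) linearP hf hf'.
  by rewrite -[X in i X]/(c *: a x + a' x) linearP -ha -ha'.
- move=> f fl; have [h hl hP] := pP B C q _ (lin_comp (linearP p) fl) qs.
  have [||u|a al aP] := @factor_inj R (submod (kernel p)) A B i (fun u => h (val u)).
  + by move=> a x y; rewrite linearP hl.
  + exact: ii.
  + by apply/iq; rewrite hP kernelP (lin0 fl).
  by exists a => //; exists h; split=> // u; rewrite aP.
(* If [a] extends to [k : P -> A], then h - i k vanishes on ker p and descends to a lift of [f]. *)
- move=> f a fl al [h [hl hf ha]] [k kl kP].
  have dl : linear (fun x => h x - i (k x)).
    by move=> c x y; rewrite hl kl linearP scalerBr opprD addrACA.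
  have [x|m ml mP] := factor_surj dl ps.
    by move=> /kernel_sub[u <-]; rewrite kP ha subrr.
  exists m => // l; have [x <-] := ps l; rewrite mP linearB hf.
  by have /iq -> : exists a, i a = i (k x); [exists (k x)|rewrite subr0].
Qed.

(** Every submodule of [P] is a kernel, so this is injectivity relative to noetherian modules; over
    a noetherian ring it says that Ext^1(N, X) = 0 for N finitely generated. *)
Definition acyclic X : Prop := forall P K (p : {linear P -> K}),
  noeth P -> lin_maps (submod (kernel p)) X `<=` extendable p X.

(** For n = 0, let L be the syzygy ker p: Hom(L, C) modulo the maps that lift to B is controlled by
    Ext^1(L, A), and a lift L -> B extends to P because B is acyclic, so liftable maps are
    extendable. *)
Lemma ext_small_shift n K A B C (i : {linear A -> B}) (q : {linear B -> C}) :
  noeth (R^o : lmodType R) -> injective i -> (forall c, exists b, q b = c) ->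
  (forall b, q b = 0 <-> exists a, i a = b) -> acyclic B ->
  ext_small n.+1 K A -> ext_small n K C.
Proof.
move=> nR ii qs iq aB; elim: n K => [|n IH] K sA P p pP nP ps; last first.
  by apply: IH; exact: sA.
have nL : noeth (submod (kernel p)) by exact: noeth_submod.
have /= sL := hom_liftable_small nR nL ii qs iq (sA _ _ pP nP ps).
apply: small_sub sL => //; first exact: lin_maps_submod.
move=> f [fl [m ml mP]]; have [g gl gP] := aB _ _ p nP m ml.
exists (fun x => q (g x)) => [|u]; last by rewrite gP mP.
by apply: lin_comp => //; exact: linearP.
Qed.

End ExtDimensionShift.

(** * From [Ext] by injective resolutions to [ext_small] by syzygies *)

Section ExtResolution.
Context (R : comPzRingType) (Serre : lmodType R -> Prop).
Implicit Types K P X : lmodType R.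
Local Notation small := (small Serre).

Lemma res_proj_surj X n c : exists x, res_proj X n x = c.
Proof. exact: qproj_surj. Qed.

Lemma res_proj_eq0 X n x : res_proj X n x = 0 <-> exists y, inj_emb (cosyzygy X n) y = x.
Proof. by split=> [/qproj_eq0/mk_submodP|xi]; last exact/qproj_eq0/mk_submodP. Qed.

(** By exactness of the resolution, the cocycles in Hom(K, E^(n+1)) are the maps into the embedded
    cosyzygy, and the coboundaries are those that lift to E^n. *)
Lemma Ext_liftable_small n K X : Serre (Ext n.+1 K X) ->
  small (lin_maps K (cosyzygy X n.+1)) (liftable K (res_proj X n)).
Proof.
move=> /small_homology; apply: (@small_rel _ _ _ _ _ _ _ _
  (fun f v => forall k, inj_emb (cosyzygy X n.+1) (f k) = val v k)).
- exact: (kernel_submod_set (hom_map K (res_diff X n.+1))).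
- split=> [k|a f f' v v' fv fv' k]; first by rewrite linear0.
  by rewrite -[LHS]/(inj_emb _ (a *: f k + f' k)) linearP fv fv'.
- move=> f fl.
  have gl : linear (fun k => inj_emb (cosyzygy X n.+1) (f k)).
    by apply: lin_comp => //; exact: linearP.
  have gH : (fun k => inj_emb (cosyzygy X n.+1) (f k)) \in mk_submod (linear_submod_set K _).
    exact/mk_submodP.
  exists (Submod gH) => //; apply: val_inj; apply/funext => k.
  by apply/(res_diff_eq0 (M := X)); exists (f k).
- move=> f v fl _ fv [g gv]; exists (val g).
    by case: g {gv} => g gH; have /mk_submodP := gH.
  by move=> k; apply: (inj_emb_spec _).2; rewrite fv -gv.
Qed.

(** Both quotients describe Ext^1 of K into the n-th cosyzygy, one by its injective container, the
    other by [p]. They are linked by a map [h] from P to the container that restricts to [f] on ker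
    p and induces [g] on K. *)
Lemma liftable_extendable_small n K P X (p : {linear P -> K}) :
  (forall k, exists x, p x = k) ->
  small (lin_maps K (cosyzygy X n.+1)) (liftable K (res_proj X n)) ->
  small (lin_maps (submod (kernel p)) (cosyzygy X n)) (extendable p (cosyzygy X n)).
Proof.
move=> ps; pose e := inj_emb (cosyzygy X n); pose q := res_proj X n.
have [Einj ei] := inj_emb_spec (cosyzygy X n).
apply: (@small_rel _ _ _ _ _ _ _ _ (fun f g => exists h : P -> inj_cont (cosyzygy X n),
  [/\ linear h, forall u, h (val u) = e (f u) & forall x, q (h x) = g (p x)])).
- exact: lin_maps_submod.
- split; first by exists (fun=> 0); split=> [a x y|x|u]; rewrite ?scaler0 ?addr0 ?linear0.
  move=> c f f' g g' [h [hl hf hg]] [h' [hl' hf' hg']]; exists (c *: h + h').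
  split=> [|x|x]; first exact: (lin_maps_submod _ _).2.
    by rewrite -[RHS]/(e (c *: f x + f' x)) linearP -hf -hf'.
  by rewrite -[X in q X]/(c *: h x + h' x) linearP hg hg'.
- move=> f fl.
  have efl : linear (fun u => e (f u)) by apply: lin_comp => //; exact: linearP.
  have [h hP] := Einj _ _ (val : {linear submod (kernel p) -> P}) (mklin efl) val_inj.
  have qhl : linear (fun x => q (h x)) by apply: lin_comp; exact: linearP.
  have [x|g gl gP] := factor_surj qhl ps.
    by move=> /kernel_sub[u <-]; rewrite hP; apply/res_proj_eq0; exists (f u).
  by exists g => //; exists h; split=> //; exact: linearP.
- move=> f g fl gl [h [hl hf hg]] [g' gl' gP].
  have dl : linear (fun x => h x - g' (p x)).
    by move=> c x y; rewrite hl linearP gl' scalerBr opprD addrACA.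
  have [x|k kl kP] := factor_inj dl ei.
    by apply/res_proj_eq0; rewrite linearB -/q hg gP subrr.
  exists k => // u; apply: ei; rewrite kP kernelP (lin0 gl') subr0.
  exact: hf.
Qed.

(** Each induction step trades one cosyzygy of X for one syzygy of K; an extension to the projective
    P lifts along [res_proj], so extendable maps are liftable. *)
Lemma liftable_ext_small n K X :
  small (lin_maps K (cosyzygy X n.+1)) (liftable K (res_proj X n)) ->
  ext_small Serre n K X.
Proof.
elim: n K => [|n IH] K sK P p pP nP ps; first exact: (liftable_extendable_small (n := 0) ps sK).
apply: IH; apply: small_sub (liftable_extendable_small ps sK) => //.
  exact: lin_maps_submod.
move=> f [fl [g gl gP]].
have [h hl hP] := pP _ _ _ g gl (@res_proj_surj X n).
by exists (fun u => h (val u)) => [a x y|u]; rewrite ?linearP ?hl ?hP.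
Qed.

Lemma Ext_ext_small n K X : Serre (Ext n.+1 K X) -> ext_small Serre n K X.
Proof. by move=> /Ext_liftable_small/liftable_ext_small. Qed.

End ExtResolution.

(** * Acyclicity of the torsion part of an injective module *)

Section PairTorsionAcyclic.
Context (R : comPzRingType).
Implicit Types I J K : ideal R.

Lemma noetherian_noeth : noetherian R -> noeth (R^o : lmodType R).
Proof.
move=> nR P Ps; have [n [g gP]] := nR (mk_submod Ps).
exists (map g (enum 'I_n)) => [_ /mapP[i _ ->]|x /(mk_submodP Ps)/gP[c ->]].
  apply/(mk_submodP Ps)/gP; exists (fun j => (j == i)%:R).
  rewrite (bigD1 i) //= eqxx mul1r big1 ?addr0 // => j /negPf ->.
  by rewrite mul0r.
rewrite -big_enum /=; elim: (enum 'I_n) => [|i s IH]; first by rewrite big_nil.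
by exists (c i); rewrite big_cons addrAC subrr add0r.
Qed.

(** Double induction, on [s] and on the exponent n of its head g: (K : g) contains g^(n-1), K + (g)
    disposes of one generator, and (K : g)(K + (g)) lies in K. *)
Lemma ideal_pow_le_radical I K (s : seq (R^o : lmodType R)) :
  (forall x, x \in I -> exists2 k, k \in K & spanned s (x - k)) ->
  (forall g, g \in s -> exists n, (g : R) ^+ n \in K) ->
  exists N, ideal_le (ideal_pow I N) K.
Proof.
elim: s K => [|g s IH] K Is sK.
  exists 1%N; apply: ideal_prod_min => x y xI _; rewrite mulrC; apply: (@rpredZ R R^o K).
  by have [k kK /= /eqP] := Is _ xI; rewrite subr_eq0 => /eqP ->.
have [|n gn] := sK g; first by rewrite inE eqxx.
elim: n K Is sK gn => [|n IHn] K Is sK gn.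
  exists 0%N => x _; rewrite -[x]mulr1; apply: (@rpredZ R R^o K).
  by rewrite expr0 in gn.
have KC x : x \in K -> x \in mk_submod (ideal_colon_set K g).
  by move=> xK; apply/mk_submodP; exact: (@rpredZ R R^o K).
have [|||N1 N1P] := IHn (mk_submod (ideal_colon_set K g)).
- by move=> x /Is[k kK xs]; exists k => //; exact: KC.
- by move=> h /sK[m hm]; exists m; exact: KC.
- by apply/(mk_submodP (ideal_colon_set K g)); rewrite /= -exprS.
have ml : linear (fun c : R^o => (c : R) *: g).
  by move=> a x y; rewrite scalerDl scalerA.
pose Kg := ideal_sum K (im_submod (mklin ml)).
have KKg x : x \in K -> x \in Kg.
  move=> xK; apply/mk_submodP; exists x, 0; rewrite addr0; split=> //.
  exact: (@rpred0 _ _).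
have [||N2 N2P] := IH Kg.
- move=> x /Is[k kK /= [c xs]]; exists (k + c * g); last by rewrite opprD addrA.
  apply/(mk_submodP (ideal_sum_set K (im_submod (mklin ml)))); exists k, (c * g).
  by split=> //; apply/(mk_submodP (im_submod_set (mklin ml))); exists c.
- by move=> h hs; have [|m hm] := sK h; [rewrite inE hs orbT|exists m; exact: KKg].
exists (N1 + N2)%N; apply: ideal_powD_min => x y /N1P/mk_submodP/= xK /N2P/mk_submodP[k [z [kK]]].
move=> /mk_submodP[c /= <-] ->; rewrite mulrDr; apply: (@rpredD _ K).
  exact: (@rpredZ R R^o K).
rewrite -[c *: g]/(c * g) mulrCA [x * g]mulrC; exact: (@rpredZ R R^o K).
Qed.

Context (I J : ideal R).

Lemma ideal_pow_expr x n : x \in I -> x ^+ n \in ideal_pow I n.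
Proof.
move=> xI; elim: n => [|n IH]; first by apply/mk_submodP.
by rewrite exprS; apply: ideal_prod_mem.
Qed.

Lemma pair_torsion_expr (X : lmodType R) (y : X) :
  y \in mk_submod (pair_torsion_set I J X) ->
  forall x, x \in I -> exists n, exists2 j, j \in J & x ^+ n *: y = j *: y.
Proof.
move=> /mk_submodP[n [_ nP]] x xI; exists n.
by apply: nP; exists (x ^+ n) => //; exact: ideal_pow_expr.
Qed.

(** The transporter ideal of all r with r y in J y contains a power of each generator of I, hence a
    power of I. Torsion can thus be tested one element of I at a time. *)
Lemma expr_pair_torsion (X : lmodType R) (y : X) : noeth (R^o : lmodType R) ->
  (forall x, x \in I -> exists n, exists2 j, j \in J & x ^+ n *: y = j *: y) ->
  y \in mk_submod (pair_torsion_set I J X).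
Proof.
move=> nR yP; have [|s sI ssp] := nR (fun x => x \in I).
  by split=> [|a x z xI zI]; [exact: (@rpred0 _ I)|apply: rpredD => //; exact: rpredZ].
have [||N NP] := @ideal_pow_le_radical I (mk_submod (orbit_transporter_set J y)) s.
- by move=> x xI; exists 0; [exact: rpred0|rewrite subr0; exact: ssp].
- move=> g /sI/yP[n [j jJ gn]]; exists n.
  by apply/(mk_submodP (orbit_transporter_set J y)); exists j.
(* [N] may be 0, while torsion asks for an exponent at least 1. *)
apply/mk_submodP; exists N.+1; split=> // _ [r rI ->].
suff /mk_submodP : r \in mk_submod (orbit_transporter_set J y) by [].
apply: (ideal_prod_min _ rI) => a b aI /NP bK; exact: (@rpredZ R R^o _).
Qed.

(* For [f] defined on [L <= P], take [V <= P] maximal with [V :&: L = ker f]. If [z]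
   kills the image of [f], then [V] is [(V : z^n) :&: (V + z^n P)] for large [n], so
   maximality gives [z^n P <= V]: an extension of [f] that vanishes on [V] has its
   image in the torsion part. *)
Lemma acyclic_gamma (E : lmodType R) : noeth (R^o : lmodType R) ->
  injective_module E -> acyclic (gamma_obj I J E).
Proof.
move=> nR Einj P K p nP f fl; set L := submod (kernel p) in f fl *.
pose ker : set P := [set x | exists2 u : L, val u = x & f u = 0].
pose Phi : set (set P) := [set V | [/\ submod_set V, ker `<=` V &
  forall u : L, V (val u) -> f u = 0]].
have PhiK : Phi ker.
  split=> // [|u [v /val_inj <-]//]; split=> [|a _ _ [u <- fu] [v <- fv]].
    by exists 0; rewrite ?linear0 ?(lin0 fl).
  by exists (a *: u + v); rewrite ?linearP // fl fu fv scaler0 addr0.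
have [V [Vs kerV Vf] Vmax] := noeth_max nP (fun V (h : Phi V) => let: And3 h _ _ := h in h) PhiK.
(* The graph of v + u |-> f u on V + L, single-valued because [f] vanishes on the intersection of V
   and L. *)
pose r x e := exists2 u : L, V (x - val u) & e = val (f u).
have [||g gl gP] := @injective_module_linrel R E P r Einj.
- split; first by exists 0; rewrite ?(lin0 fl) !linear0 ?addr0 //; exact: Vs.1.
  move=> a x x' e e' [u xu ->] [u' xu' ->]; exists (a *: u + u').
    rewrite [\val (_ + _)]linearP opprD addrACA -scalerBr; exact: Vs.2.
  by rewrite fl linearP.
- move=> _ [u Vu ->]; rewrite (Vf u) ?linear0 //.
  by have := submod_setB Vs Vs.1 Vu; rewrite !sub0r opprK.
have gV x : V x -> g x = 0.
  move=> Vx; apply: gP; exists 0; first by rewrite !linear0 addr0.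
  by rewrite (lin0 fl).
have gf u : g (val u) = val (f u).
  by apply: gP; exists u => //; rewrite subrr; exact: Vs.1.
have zV z : (forall u, z *: f u = 0) -> exists n, forall x, V (z ^+ n *: x).
  move=> zf; have [n|n x Vx|n nV] := @noeth_acc R P (fun n => [set x | V (z ^+ n *: x)]) nP.
  - split=> /= [|a x y Vx Vy]; first by rewrite scaler0; exact: Vs.1.
    by rewrite scalerDr scalerA mulrC -scalerA; exact: Vs.2.
  - by rewrite /= exprS -scalerA; exact: submod_setZ.
  have nkV k x : V (z ^+ (n + k) *: x) -> V (z ^+ n *: x).
    elim: k x => [|k IH] x; first by rewrite addn0.
    by rewrite addnS -addSn exprD -scalerA => /nV; rewrite /= scalerA -exprD; exact: IH.
  pose V' : set P := [set y | exists v x, V v /\ y = v + z ^+ n *: x].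
  have VV' : V `<=` V' by move=> v Vv; exists v, 0; rewrite scaler0 addr0.
  have PhiV' : Phi V'.
    split=> [|x /kerV/VV'//|u [v [x [Vv uE]]]].
      split=> [|a _ _ [v [x [Vv ->]]] [w [y [Vw ->]]]]; first exact/VV'/Vs.1.
      exists (a *: v + w), (a *: x + y); split; first exact: Vs.2.
      by rewrite !scalerDr !scalerA [a * _]mulrC addrACA.
    (* With u = v + z^n x, multiply by z^(n+1): the exponent is positive, so z^(n+1) u is in ker f,
       hence in V. Then z^(2n+1) x is in V, and so is z^n x by the choice of n. *)
    apply: Vf; rewrite uE; apply: submod_setD => //; apply: (nkV n.+1).
    have -> : z ^+ (n + n.+1) *: x = z ^+ n.+1 *: val u - z ^+ n.+1 *: v.
      by rewrite uE scalerDr addrAC subrr add0r scalerA -exprD addnC.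
    apply: submod_setB => //; last exact: submod_setZ.
    rewrite exprSr -scalerA; apply: submod_setZ => //; apply: kerV.
    by exists (z *: u); rewrite ?linearZ // (linZ fl) zf.
  exists n => x; apply: (Vmax _ PhiV' VV'); exists 0, x; rewrite add0r.
  by split=> //; exact: Vs.1.
have gT x : g x \in mk_submod (pair_torsion_set I J E).
  apply: expr_pair_torsion => // b bI.
  (* Elements b^m - j with j in J are closed under products. Each generator of L has its image under
     [f] killed by one of them, so the product z kills all of f(L); then z^n kills g(P), and z^n =
     b^m - j reads b^m g(x) = j g(x). *)
  pose form a := exists m, exists2 j, j \in J & a = b ^+ m - j.
  have form1 : form 1 by exists 0%N, 0; [exact: (@rpred0 _ J)|rewrite expr0 subr0].
  have formM a a' : form a -> form a' -> form (a * a').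
    move=> [m [j jJ ->]] [m' [j' jJ' ->]]; exists (m + m')%N.
    exists (b ^+ m * j' + (b ^+ m' - j') * j).
      by apply: (@rpredD _ J); exact: (@rpredZ R R^o J).
    by rewrite exprD mulrBl mulrBr [j * _]mulrC opprD addrA.
  have [z zform zf] : exists2 z, form z & forall u, z *: f u = 0.
    have [|s _ ssp] := @noeth_submod R P (kernel p) nP setT; first by split.
    suff [z zform zs] : exists2 z, form z & forall u, spanned s u -> z *: f u = 0.
      by exists z => // u; apply/zs/ssp.
    elim: s {ssp} => [|u s [z zform zs]].
      by exists 1 => // u /= ->; rewrite (lin0 fl) scaler0.
    have [|m [j jJ uj]] := pair_torsion_expr (y := val (f u)) _ bI.
      exact: (submod_valP (f u)).
    exists ((b ^+ m - j) * z); first by apply: formM => //; exists m, j.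
    move=> v /= [c /zs zv]; rewrite -[v](subrK (c *: u)) (linD fl) scalerDr.
    rewrite -scalerA zv scaler0 add0r (linZ fl) scalerA mulrC -!scalerA.
    rewrite [(_ - _) *: _]scalerA [_ * z]mulrC -scalerA.
    rewrite [(_ - _) *: _](_ : _ = 0) ?scaler0 //.
    by apply: val_inj; rewrite /= scalerBl uj subrr.
  have [n nV] := zV z zf.
  have [m [j jJ zn]] : form (z ^+ n).
    by elim: n {nV} => [|n IH]; rewrite ?expr0 // exprS; exact: formM.
  exists m, j => //; apply/eqP; rewrite -subr_eq0 -scalerBl -zn -(linZ gl).
  by apply/eqP/gV.
have [g' gP'] := factor_submod gl gT.
exists g' => [|u]; first exact: linearP.
by apply: val_inj; rewrite gP' gf.
Qed.

End PairTorsionAcyclic.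

(** * Complexes of acyclic modules, their boundaries and their cohomology *)

Section AcyclicComplex.
Context (R : comPzRingType) (Serre : lmodType R -> Prop).
Context (serreS : serre_subcategory Serre).
Context (nR : noeth (R^o : lmodType R)) (K : lmodType R) (nK : noeth K).
Context (G : nat -> lmodType R) (d : forall n, {linear G n -> G n.+1}).
Context (dd : forall n x, d n.+1 (d n x) = 0) (aG : forall n, acyclic (G n)).

Definition boundary n : set (G n) :=
  if n is n'.+1 then [set x | exists y, d n' y = x] else [set 0].

Lemma boundary_submod n : submod_set (@boundary n).
Proof.
case: n => [|n]; last exact: im_submod_set.
by split=> // a x y -> ->; rewrite scaler0 addr0.
Qed.

Lemma boundary_cycle n x : boundary x -> d n x = 0.
Proof. by case: n x => [|n] x; [move=> ->; rewrite linear0|move=> [y <-]]. Qed.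

Local Notation Z n := (submod (kernel (d n))).
Local Notation B n := (submod (mk_submod (boundary_submod n))).

Lemma boundaryP n (b : B n) : boundary (val b).
Proof. by case: b => x xB; have /mk_submodP := xB. Qed.

Lemma boundary_sub n x : @boundary n x -> exists b : B n, val b = x.
Proof.
by move=> xB; have xB' : x \in mk_submod (boundary_submod n);
  [apply/mk_submodP|exists (Submod xB')].
Qed.

Context (H : nat -> lmodType R) (q : forall n, {linear Z n -> H n}).
Context (qs : forall n h, exists z, q n z = h).
Context (q0 : forall n z, q n z = 0 <-> boundary (val z)).

Lemma boundary_inclusion n : exists i : {linear B n -> Z n},
  injective i /\ forall z, q n z = 0 <-> exists b, i b = z.
Proof.
have [||i iP] := @factor_submod R (B n) (G n) (kernel (d n)) val.
- exact: linearP.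
- by move=> b; apply/mk_submodP/boundary_cycle/boundaryP.
exists i; split=> [b b' /(congr1 val)|z]; first by rewrite !iP => /val_inj.
rewrite q0; split=> [/boundary_sub[b bz]|[b <-]].
  by exists b; apply: val_inj; rewrite iP bz.
by rewrite iP; exact: boundaryP.
Qed.

Lemma boundary_projection n : exists p : {linear G n -> B n.+1},
  (forall b, exists x, p x = b) /\ forall x, p x = 0 <-> exists z : Z n, val z = x.
Proof.
have [||p pP] := @factor_submod R (G n) (G n.+1) (mk_submod (boundary_submod n.+1)) (d n).
- exact: linearP.
- by move=> x; apply/mk_submodP; exists x.
exists p; split=> [b|x].
  by have [x xb] := boundaryP b; exists x; apply: val_inj; rewrite pP.
split=> [px|[z <-]]; first by apply: kernel_sub; rewrite -pP px linear0.
by apply: val_inj; rewrite pP kernelP.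
Qed.

Lemma ext_small_zero n (L X : lmodType R) : (forall x : X, x = 0) -> ext_small Serre n L X.
Proof.
move=> X0; elim: n L => [|n IH] L P p _ _ _; last exact: IH.
exists X; split; first exact: (serre_zero serreS).
exists (fun _ _ => True); split=> // [f _|f _ _]; first by exists 0.
by exists (fun=> 0) => [a x y|u]; rewrite ?scaler0 ?addr0 // [RHS]X0.
Qed.

Context (t : nat) (sH : forall j, (j < t)%N -> ext_small Serre (t - j) K (H j)).

(** As [ext_small n] is Ext^(n+1), the total degree is t + 1 throughout. Ext^(n+1)(K, B^(j+1))
    shifts to Ext^(n+2)(K, Z^j), which lies between the same Ext of B^j and of H^j. *)
Lemma ext_small_boundary n j : (n + j = t)%N -> ext_small Serre n K (B j).
Proof.
elim: j n => [|j IH] n nj.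
  by apply: ext_small_zero => b; apply: val_inj; exact: (boundaryP b).
have [i [ii iq]] := boundary_inclusion j; have [p [ps p0]] := boundary_projection j.
apply: (@ext_small_shift R Serre n K (Z j) (G j) (B j.+1) val p nR val_inj ps p0 (@aG j)).
apply: (ext_small_middle serreS ii (@qs j) iq); first by apply: IH; rewrite addSnnS.
have -> : n.+1 = (t - j)%N by rewrite -nj -addSnnS addnK.
by apply: sH; rewrite -nj addnS ltnS leq_addl.
Qed.

(** Maps K -> H^t modulo those that lift to Z^t are controlled by Ext^1(K, B^t). Those that lift
    come from cocycles K -> G^t, and a lift with values in boundaries induces 0. *)
Lemma hom_homology_small :
  small Serre [set f : K -> G t | linear f /\ forall k, d t (f k) = 0]
    [set f | forall k, boundary (f k)] ->
  small Serre (lin_maps K (H t)) [set 0].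
Proof.
move=> sG; have [i [ii iq]] := boundary_inclusion t.
apply: (small_ext serreS (M := liftable K (q t))).
- exact: lin_maps_submod.
- exact: liftable_submod.
- by split=> // a f g -> ->; rewrite scaler0 addr0.
- apply: (hom_liftable_small nR nK ii (@qs t) iq).
  exact: ext_small_boundary.
apply: (@small_rel _ _ _ _ _ _ _ _
  (fun h f => forall k, exists2 z : Z t, val z = f k & q t z = h k) _ _ _ _ sG).
- split; first by split=> [a x y|k]; rewrite ?scaler0 ?addr0 ?linear0.
  move=> a f g [fl fz] [gl gz]; split; first exact: (lin_maps_submod _ _).2.
  by move=> k; rewrite -[X in d t X]/(a *: f k + g k) linearP fz gz scaler0 addr0.
- split=> [k|a h h' f f' hf hf' k]; first by exists 0; rewrite linear0.
  have [z zf zh] := hf k; have [z' zf' zh'] := hf' k.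
  exists (a *: z + z'); first by rewrite -[RHS]/(a *: f k + f' k) -zf -zf'; exact: linearP.
  by rewrite [LHS]linearP zh zh'.
- move=> h [hl [g gl gh]]; exists (fun k => val (g k)) => [|k]; last by exists (g k).
  by split=> [a x y|k]; [rewrite gl linearP|exact: kernelP].
- move=> h f _ _ hf fB; apply/funext => k.
  by have [z zf <-] := hf k; apply/q0; rewrite zf.
Qed.

End AcyclicComplex.

(** * The torsion complex of the injective resolution *)

Section LocalCohomology.
Context (R : comPzRingType) (I J a : ideal R) (Wa : Wtilde I J a) (M : lmodType R).

(** An element of I^n is x + y with x in [a] and y in J; x kills R/a, so x + y acts on the image of
    [f] as y does. *)
Lemma hom_pair_torsion (X : lmodType R) (f : quotient_by a -> X) k : linear f ->
  f k \in mk_submod (pair_torsion_set I J X).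
Proof.
move=> fl; have [n [n1 nP]] := Wa; apply/mk_submodP; exists n; split=> // _ [r /nP rI ->].
have /(mk_submodP (ideal_sum_set a J))[x [y [xa yJ ->]]] := rI.
exists y => //; have [s sk] := qproj_surj k.
have xk : x *: k = 0.
  rewrite -sk -linearZ; apply/qproj_eq0; rewrite -[x *: s]/(x * s) mulrC.
  exact: (@rpredZ R R^o a).
by rewrite scalerDl -(linZ fl) xk (lin0 fl) add0r.
Qed.

Local Notation E n := (inj_res M n).
Local Notation G n := (gamma_obj I J (E n)).

Definition gamma_diff n : {linear G n -> G n.+1} := gamma_map I J (ir_diff (inj_res M) n).

Lemma gamma_diffK n x : gamma_diff n.+1 (gamma_diff n x) = 0.
Proof.
apply: val_inj => /=; apply/(ir_exact (i := inj_res M) (n := n)).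
by exists (val x).
Qed.

(** The case split lets [local_cohomology], itself defined by cases on the degree, reduce. *)
Definition cohomology_proj n :
    {linear submod (kernel (gamma_diff n)) -> local_cohomology n I J M} :=
  match n with 0%N => qproj _ | n'.+1 => qproj _ end.

Lemma cohomology_proj_surj n h : exists z, cohomology_proj n z = h.
Proof. by case: n h => [|n] h; exact: qproj_surj. Qed.

Lemma cohomology_proj_eq0 n z : cohomology_proj n z = 0 <-> boundary gamma_diff (val z).
Proof.
case: n z => [|n] z; split.
- by move=> /qproj_eq0/mk_submodP[u uz]; exact: esym uz.
- by move=> z0; apply/qproj_eq0/mk_submodP; exists 0; rewrite linear0 z0.
- by move=> /qproj_eq0/mk_submodP[u uz]; exists u.
- by move=> [u uz]; apply/qproj_eq0/mk_submodP; exists u.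
Qed.

Context (Serre : lmodType R -> Prop).

(** The inclusion of G^t in E^t sends cocycles to cocycles of Hom(R/a, E). A coboundary d u there
    has its values in the boundaries of G, since [u] has torsion values by [hom_pair_torsion]. *)
Lemma Ext_hom_gamma t : Serre (Ext t (quotient_by a) M) ->
  small Serre [set f : quotient_by a -> G t | linear f /\ forall k, gamma_diff t (f k) = 0]
    [set f | forall k, boundary gamma_diff (f k)].
Proof.
move=> SE; have sE : small Serre
    [set v | hom_map (quotient_by a) (ir_diff (inj_res M) t) v = 0]
    [set v | forall k (x : G t), val x = val v k -> boundary gamma_diff x].
  case: t SE => [|t] /small_homology; apply: small_sub => //.
  - exact: (kernel_submod_set (hom_map _ _)).
  - by move=> v [_ [u <-]] k x xv; apply: val_inj; rewrite xv.
  - exact: (kernel_submod_set (hom_map _ _)).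
  - move=> v [_ [u <-]] k x xv.
    have ul : linear (val u) by case: u {xv} => u uH; have /mk_submodP := uH.
    by exists (Submod (hom_pair_torsion k ul)); apply: val_inj.
apply: (@small_rel _ _ _ _ _ _ _ _ (fun f v => forall k, val (f k) = val v k) _ _ _ _ sE).
- exact: (kernel_submod_set (hom_map _ _)).
- split=> [k|c f f' v v' fv fv' k] //.
  rewrite -[RHS]/(c *: val v k + val v' k) -fv -fv'; exact: linearP.
- move=> f [fl fd].
  have gl : linear (fun k => val (f k)) by move=> c x y; rewrite fl linearP.
  have gH : (fun k => val (f k)) \in mk_submod (linear_submod_set (quotient_by a) (E t)).
    exact/mk_submodP.
  exists (Submod gH) => //; apply: val_inj; apply/funext => k.
  exact: (congr1 val (fd k)).
- by move=> f v _ _ fv vB k; apply: (vB k).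
Qed.

End LocalCohomology.

Theorem corollary2p3 (R : comPzRingType) (I J : ideal R) (t : nat)
    (M : lmodType R) (Serre : lmodType R -> Prop) (a : ideal R)
    (noethR : noetherian R) (serreS : serre_subcategory Serre)
    (Wa : Wtilde I J a)
    (ExtM : Serre (Ext t (quotient_by a) M))
    (ExtH : forall n j : nat, n = t \/ n = t.+1 -> (j < t)%N ->
      Serre (Ext (n - j) (quotient_by a) (local_cohomology j I J M))) :
  Serre (hom_module (quotient_by a) (local_cohomology t I J M)).
Proof.
have nR := noetherian_noeth noethR.
have nK : noeth (quotient_by a) := noeth_surj (@qproj_surj R R^o a) nR.
have sH j : (j < t)%N -> ext_small Serre (t - j) (quotient_by a) (local_cohomology j I J M).
  (* [ext_small (t - j)] is Ext in degree (t - j) + 1 = (t + 1) - j. *)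
  move=> jt; apply: Ext_ext_small; rewrite -subSn ?(ltnW jt) //.
  by apply: ExtH => //; right.
have := hom_homology_small serreS nR nK (@gamma_diffK R I J M)
  (fun n => @acyclic_gamma R I J _ nR (@ir_injective R M (inj_res M) n))
  (@cohomology_proj_surj R I J M) (@cohomology_proj_eq0 R I J M) sH
  (Ext_hom_gamma Wa ExtM).
move=> sHom; apply: (serre_small serreS).
apply: (@small_rel _ _ _ _ _ _ _ _ (fun v h => h = val v) _ _ _ _ sHom).
- exact: lin_maps_submod.
- by split=> // c v v' h h' -> ->.
- by move=> v _; exists (val v) => //; case: v => v vH; have /mk_submodP := vH.
- by move=> v h _ _ -> v0; apply: val_inj.
Qed.
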